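(* Let $B\in so(4)$ and $\theta\in\mathbb{R}$, and let $Z,W:\mathbb{R}^{18}\to\mathbb{R}^{18}$ be the vector fields (depending on $B,\theta$) defined in the context. Let $x^0=(p^0,V_1^0,V_2^0,\nu^0,r^0,s^0)\in\mathbb{R}^{18}$ be such that $\{p^0,V_1^0,V_2^0,\nu^0\}$ is an orthonormal basis of $\mathbb{R}^4$. Let $\Theta_Z,\Theta_W:\mathbb{R}\times\mathbb{R}^{18}\to\mathbb{R}^{18}$ be the flows of $Z$ and $W$, and define $\phi:\mathbb{R}^2\to\mathbb{R}^{18}$ by $$\phi(u,v)=\Theta_Z(u,\Theta_W(v,x^0))=(\phi_1(u,v),\dots,\phi_{18}(u,v)).$$ Let $\rho=(\phi_1,\dots,\phi_4):\mathbb{R}^2\to\mathbb{R}^4$. Then $\rho(\mathbb{R}^2)\subset S^3$, and $\rho:\mathbb{R}^2\to S^3$ is a minimal immersion whose principal curvatures at $\rho(u,v)$ are $\pm e^{2\phi_{17}(u,v)}$. More precisely, $\nu=(\phi_{13},\phi_{14},\phi_{15},\phi_{16}):\mathbb{R}^2\to\mathbb{R}^4$ is a Gauss map (unit normal in $S^3$) of the immersion $\rho$, and $(\phi_5,\phi_6,\phi_7,\phi_8)$ and $(\phi_9,\phi_{10},\phi_{11},\phi_{12})$ are principal directions of the immersion $\rho$.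
   Context: $so(4)$ is the space of real skew-symmetric $4\times4$ matrices, $\langle\cdot,\cdot\rangle$ the Euclidean inner product of $\mathbb{R}^4$, $S^3\subset\mathbb{R}^4$ the unit sphere. Points of $\mathbb{R}^{18}$ are written $(p,V_1,V_2,\nu,r,s)$ with $p,V_1,V_2,\nu\in\mathbb{R}^4$ and $r,s\in\mathbb{R}$ (so coordinates $1$–$4$ are $p$, $5$–$8$ are $V_1$, $9$–$12$ are $V_2$, $13$–$16$ are $\nu$, $17$ is $r$, $18$ is $s$). The vector field $Z=(Z_1,\dots,Z_6)$ has components $Z_1=e^{-r}(\cos\theta\,V_1+\sin\theta\,V_2)$, $Z_2=sV_2+\cos\theta\,(e^{r}\nu-e^{-r}p)$, $Z_3=-sV_1-\sin\theta\,(e^{r}\nu+e^{-r}p)$, $Z_4=e^{r}(-\cos\theta\,V_1+\sin\theta\,V_2)$, $Z_5=\langle Bp,\nu\rangle$, $Z_6=\cos\theta\,\langle BV_2,e^{-r}\nu-e^{r}p\rangle-\sin\theta\,\langle BV_1,e^{-r}\nu+e^{r}p\rangle$. The vector field $W=(W_1,\dots,W_6)$ has components $W_1=e^{-r}(\cos\theta\,V_2-\sin\theta\,V_1)$, $W_2=-\langle Bp,\nu\rangle V_2+\sin\theta\,(-e^{r}\nu+e^{-r}p)$, $W_3=\langle Bp,\nu\rangle V_1-\cos\theta\,(e^{r}\nu+e^{-r}p)$, $W_4=e^{r}(\sin\theta\,V_1+\cos\theta\,V_2)$, $W_5=s$, $W_6=e^{-2r}-e^{2r}-\sin\theta\,\langle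 BV_2,e^{-r}\nu-e^{r}p\rangle-\cos\theta\,\langle BV_1,e^{-r}\nu+e^{r}p\rangle$. A tangent vector $X$ (identified with its image under the differential of the immersion) is a principal direction if $d\nu(X)=\mp\kappa X$ for a real number; the corresponding principal curvature is $\pm\kappa$. *)

(* Defs.v *)
From HB Require Import structures.
From mathcomp Require Import all_boot all_order all_algebra.
From mathcomp Require Import all_classical all_reals all_analysis.

Set Implicit Arguments.
Unset Strict Implicit.
Unset Printing Implicit Defensive.

Import Order.TTheory GRing.Theory Num.Theory.
Import numFieldNormedType.Exports.

Local Open Scope ring_scope.
Local Open Scope classical_set_scope.

(* The norm `|_| that the library puts on row vectors is the sup norm, so all
   Euclidean notions below go through [dot]. *)
Definition dot {R : realType} {n : nat} (u v : 'rV[R]_n) : R :=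
  (u *m v^T) 0 0.

Definition so4 {R : realType} : set 'M[R]_4 := [set B | B^T = - B].

Definition sphere3 {R : realType} : set 'rV[R]_4 := [set y | dot y y = 1].

Definition orthonormal_basis {R : realType} {n : nat}
    (e : n.-tuple 'rV[R]_n) : Prop :=
  basis_of fullv e /\
  forall i j : 'I_n, dot (tnth e i) (tnth e j) = (i == j)%:R.

(* Vectors are rows, so the usual B v (v a column) is v *m B^T. *)
Definition mxact {R : realType} {n : nat} (B : 'M[R]_n) (v : 'rV[R]_n) :
    'rV[R]_n := v *m B^T.

(** * The phase space *)

(* x = (p, V1, V2, nu, r, s); indices start at 0 here, so that the coordinates
   numbered k+1, ..., k+4 from 1 are [block4 k x], and r is the 17th one. *)
Definition block4 {R : realType} (k : nat) (x : 'rV[R]_18) : 'rV[R]_4 :=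
  \row_(j < 4) x 0 (inord (k + j)).

Definition pt_of {R : realType} (x : 'rV[R]_18) := block4 0 x.
Definition V1_of {R : realType} (x : 'rV[R]_18) := block4 4 x.
Definition V2_of {R : realType} (x : 'rV[R]_18) := block4 8 x.
Definition nu_of {R : realType} (x : 'rV[R]_18) := block4 12 x.
Definition r_of {R : realType} (x : 'rV[R]_18) : R := x 0 (inord 16).
Definition s_of {R : realType} (x : 'rV[R]_18) : R := x 0 (inord 17).

Definition pack {R : realType} (p V1 V2 nu : 'rV[R]_4) (r s : R) :
    'rV[R]_18 :=
  row_mx p (row_mx V1 (row_mx V2 (row_mx nu
    (row_mx (r%:M : 'rV_1) (s%:M : 'rV_1))))).

Lemma pt_of_pack {R : realType} (p V1 V2 nu : 'rV[R]_4) (r s : R) :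
  pt_of (pack p V1 V2 nu r s) = p.
Proof.
apply/rowP => j; rewrite mxE /pack.
rewrite (_ : inord _ = lshift (4 + (4 + (4 + (1 + 1)))) j :> 'I_18).
  by rewrite (row_mxEl p).
by apply: val_inj; rewrite /= inordK //; case: j => -[|[|[|[]]]].
Qed.

Lemma V1_of_pack {R : realType} (p V1 V2 nu : 'rV[R]_4) (r s : R) :
  V1_of (pack p V1 V2 nu r s) = V1.
Proof.
apply/rowP => j; rewrite mxE /pack.
rewrite (_ : inord _ =
    rshift 4 (lshift (4 + (4 + (1 + 1))) j) :> 'I_18).
  by rewrite (row_mxEr p) (row_mxEl V1).
by apply: val_inj; rewrite /= inordK //; case: j => -[|[|[|[]]]].
Qed.

Lemma V2_of_pack {R : realType} (p V1 V2 nu : 'rV[R]_4) (r s : R) :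
  V2_of (pack p V1 V2 nu r s) = V2.
Proof.
apply/rowP => j; rewrite mxE /pack.
rewrite (_ : inord _ =
    rshift 4 (rshift 4 (lshift (4 + (1 + 1)) j)) :> 'I_18).
  by rewrite (row_mxEr p) (row_mxEr V1) (row_mxEl V2).
by apply: val_inj; rewrite /= inordK //; case: j => -[|[|[|[]]]].
Qed.

Lemma nu_of_pack {R : realType} (p V1 V2 nu : 'rV[R]_4) (r s : R) :
  nu_of (pack p V1 V2 nu r s) = nu.
Proof.
apply/rowP => j; rewrite mxE /pack.
rewrite (_ : inord _ =
    rshift 4 (rshift 4 (rshift 4 (lshift (1 + 1) j))) :> 'I_18).
  by rewrite (row_mxEr p) (row_mxEr V1) (row_mxEr V2) (row_mxEl nu).
by apply: val_inj; rewrite /= inordK //; case: j => -[|[|[|[]]]].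
Qed.

Lemma r_of_pack {R : realType} (p V1 V2 nu : 'rV[R]_4) (r s : R) :
  r_of (pack p V1 V2 nu r s) = r.
Proof.
rewrite /r_of /pack (_ : inord _ = rshift 4 (rshift 4 (rshift 4 (rshift 4
    (lshift 1 (0 : 'I_1))))) :> 'I_18); last first.
  by apply: val_inj; rewrite /= inordK.
rewrite (row_mxEr p) (row_mxEr V1) (row_mxEr V2) (row_mxEr nu).
by rewrite (row_mxEl (r%:M)) mxE.
Qed.

Lemma s_of_pack {R : realType} (p V1 V2 nu : 'rV[R]_4) (r s : R) :
  s_of (pack p V1 V2 nu r s) = s.
Proof.
rewrite /s_of /pack (_ : inord _ = rshift 4 (rshift 4 (rshift 4 (rshift 4
    (rshift 1 (0 : 'I_1))))) :> 'I_18); last first.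
  by apply: val_inj; rewrite /= inordK.
rewrite (row_mxEr p) (row_mxEr V1) (row_mxEr V2) (row_mxEr nu).
by rewrite (row_mxEr (r%:M)) mxE.
Qed.

Definition Zfield {R : realType} (B : 'M[R]_4) (theta : R) (x : 'rV[R]_18) :
    'rV[R]_18 :=
  let p := pt_of x in let V1 := V1_of x in let V2 := V2_of x in
  let nu := nu_of x in let r := r_of x in let s := s_of x in
  pack
    (expR (- r) *: (cos theta *: V1 + sin theta *: V2))
    (s *: V2 + cos theta *: (expR r *: nu - expR (- r) *: p))
    (- (s *: V1) - sin theta *: (expR r *: nu + expR (- r) *: p))
    (expR r *: (- (cos theta *: V1) + sin theta *: V2))
    (dot (mxact B p) nu)
    (cos theta * dot (mxact B V2) (expR (- r) *: nu - expR r *: p)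
     - sin theta * dot (mxact B V1) (expR (- r) *: nu + expR r *: p)).

Definition Wfield {R : realType} (B : 'M[R]_4) (theta : R) (x : 'rV[R]_18) :
    'rV[R]_18 :=
  let p := pt_of x in let V1 := V1_of x in let V2 := V2_of x in
  let nu := nu_of x in let r := r_of x in let s := s_of x in
  pack
    (expR (- r) *: (cos theta *: V2 - sin theta *: V1))
    (- (dot (mxact B p) nu *: V2)
     + sin theta *: (- (expR r *: nu) + expR (- r) *: p))
    (dot (mxact B p) nu *: V1 - cos theta *: (expR r *: nu + expR (- r) *: p))
    (expR r *: (sin theta *: V1 + cos theta *: V2))
    s
    (expR (- (2 * r)) - expR (2 * r)
     - sin theta * dot (mxact B V2) (expR (- r) *: nu - expR r *: p)
     - cos theta * dot (mxact B V1) (expR (- r) *: nu + expR r *: p)).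

(* [Theta] is the global flow of [F]: each [Theta ^~ x] is the integral curve of
   [F] starting at [x].  For a smooth [F], integral curves are unique, so that
   this determines [Theta]. *)
Definition is_flow {R : realType} {n : nat} (F : 'rV[R]_n -> 'rV[R]_n)
    (Theta : R -> 'rV[R]_n -> 'rV[R]_n) : Prop :=
  forall x : 'rV[R]_n,
    Theta 0 x = x /\
    forall t : R, is_derive t (1 : R) (Theta ^~ x) (F (Theta t x)).

(** * Surfaces in the 3-sphere, parametrized by the plane *)

Fixpoint Ck {R : realType} {m n : nat} (k : nat)
    (f : 'rV[R]_m -> 'rV[R]_n) : Prop :=
  match k with
  | 0 => continuous f
  | k'.+1 => (forall w, differentiable f w) /\
             forall v : 'rV[R]_m, Ck k' (fun w => 'D_v f w)
  end.

Definition smooth {R : realType} {m n : nat} (f : 'rV[R]_m -> 'rV[R]_n) :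
    Prop := forall k, Ck k f.

(* A smooth map into the sphere is a smooth map into R^4 with values in the
   sphere, and its differential is the one of the map into R^4. *)
Definition immersion_S3 {R : realType} (f : 'rV[R]_2 -> 'rV[R]_4) : Prop :=
  [/\ smooth f, forall w, sphere3 (f w) & forall w, injective ('d f w)].

(* Unit vector, tangent to the sphere at [f w], normal to the surface. *)
Definition gauss_map {R : realType} (f N : 'rV[R]_2 -> 'rV[R]_4) : Prop :=
  smooth N /\
  forall w, [/\ sphere3 (N w), dot (N w) (f w) = 0
              & forall X : 'rV[R]_2, dot (N w) ('d f w X) = 0].

Definition fund_form1 {R : realType} (f : 'rV[R]_2 -> 'rV[R]_4)
    (w : 'rV[R]_2) : 'M[R]_2 :=
  \matrix_(i, j) dot ('d f w (delta_mx 0 i)) ('d f w (delta_mx 0 j)).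

Definition fund_form2 {R : realType} (f N : 'rV[R]_2 -> 'rV[R]_4)
    (w : 'rV[R]_2) : 'M[R]_2 :=
  \matrix_(i, j) - dot ('d N w (delta_mx 0 i)) ('d f w (delta_mx 0 j)).

Definition mean_curvature {R : realType} (f N : 'rV[R]_2 -> 'rV[R]_4)
    (w : 'rV[R]_2) : R :=
  2^-1 * \tr (invmx (fund_form1 f w) *m fund_form2 f N w).

(* An immersion of the plane in the sphere has exactly two Gauss maps, which are
   opposite, and so are their mean curvatures: the choice of [N] is harmless. *)
Definition minimal_immersion_S3 {R : realType} (f : 'rV[R]_2 -> 'rV[R]_4) :
    Prop :=
  immersion_S3 f /\
  exists2 N, gauss_map f N & forall w, mean_curvature f N w = 0.

(* T in R^4 is the image under the differential of f of a nonzero tangent vector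
   X at w with dN(X) = - kappa X, where X is identified with T. *)
Definition principal {R : realType} (f N : 'rV[R]_2 -> 'rV[R]_4)
    (w : 'rV[R]_2) (kappa : R) (T : 'rV[R]_4) : Prop :=
  T != 0 /\ exists2 X : 'rV[R]_2, 'd f w X = T & 'd N w X = - (kappa *: T).

Definition principal_curvature {R : realType} (f N : 'rV[R]_2 -> 'rV[R]_4)
    (w : 'rV[R]_2) (kappa : R) : Prop :=
  exists T, principal f N w kappa T.

Definition principal_direction {R : realType} (f N : 'rV[R]_2 -> 'rV[R]_4)
    (w : 'rV[R]_2) (T : 'rV[R]_4) : Prop :=
  exists kappa, principal f N w kappa T.

(* Main.v *)
Require Import Defs.
From HB Require Import structures.
From mathcomp Require Import all_boot all_order all_algebra.
From mathcomp Require Import ring lra.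
From mathcomp Require Import all_classical all_reals all_analysis.

Set Implicit Arguments.
Unset Strict Implicit.
Unset Printing Implicit Defensive.

Import Order.TTheory GRing.Theory Num.Theory.
Import numFieldNormedType.Exports.
Local Open Scope ring_scope.
Local Open Scope classical_set_scope.

(** Write a = e^r, b = e^{-r}, and let F be the matrix whose rows are p, V1, V2
    and nu.

    Along Z and along W one has F' = A F with a skew-symmetric A, so the matrix
    F^T F is constant and an orthonormal frame stays orthonormal
    ([orthonormal_frame_curve]).

    The two fields commute ([Zfield_Wfield_commute]).  The last two components
    are made for that: with beta = <Bp, nu> one has Z r = beta and W r = s, while
    the s-components of Z and W are W beta and b^2 - a^2 - Z beta.  The only
    bracket that is not a direct check is the one in s, and it amounts to
    (ZZ + WW) beta = - 2 (a^2 + b^2) beta, which follows from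
    (ZZ + WW) p = - 2 b^2 p and (ZZ + WW) nu = - 2 a^2 nu.

    Hence phi is an integral surface of both fields:
    dphi = Z(phi) du + W(phi) dv.  The first term is the definition of phi.  The
    second one needs the flow of Z to depend differentiably on its initial point,
    which [is_flow] does not assert, and it is obtained by hand
    ([transported_expansion]): along the curve u |-> phi(u, v), the perturbed
    curve phi + h W(phi) satisfies the equation of Z up to O(h^2), because
    DW.Z = DZ.W, so that Gronwall's inequality compares it with the true solution
    u |-> phi(u, v + h).  The error is uniform in u, which gives the full
    differential of phi at once ([commuting_flows_is_diff]).  The fields are
    exponential polynomials of the coordinates, a class that is stable under
    derivation along such fields, and iterating dphi = Z du + W dv gives the
    smoothness of phi ([smooth_expoly_comp]).

    The geometry is then read off the blocks of Z and W.  The differential of rho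
    is b times a rotation by theta of (V1, V2), and the differential of nu is its
    product with a^2 diag(-1, 1) in the basis (V1, V2), as a = a^2 b.  So V1 and
    V2 are principal directions with curvatures a^2 and - a^2, the parametrization
    is conformal, and the trace of the second form vanishes. *)

(** * Estimates on the real line *)

Section RealLine.
Context {R : realType}.
Implicit Types f df : R -> R.

Lemma is_derive_continuous f df :
  (forall t, is_derive t (1 : R) f (df t)) -> continuous f.
Proof.
by move=> fd t; apply/differentiable_continuous/derivable1_diffP; case: (fd t).
Qed.

Lemma MVT_everywhere f df (a b : R) :
  (forall t, is_derive t (1 : R) f (df t)) -> a <= b ->
  exists2 c, c \in `[a, b]%R & f b - f a = df c * (b - a).
Proof.
move=> fd ab; apply: MVT_segment => //.
exact/continuous_subspaceT/(is_derive_continuous fd).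
Qed.

(** Lets the estimates below be proved for nonnegative times only. *)
Lemma is_derive_reflect f df :
  (forall t, is_derive t (1 : R) f (df t)) ->
  forall t, is_derive t (1 : R) (fun x => f (- x)) (- df (- t)).
Proof.
move=> fd t; have H := is_derive1_comp (fd (- t)) (is_deriveNid t 1).
by apply: (is_derive_eq H); rewrite mulrN1.
Qed.

Lemma mean_value_bound f df (K t : R) :
  (forall t, is_derive t (1 : R) f (df t)) ->
  (forall x, `|x| <= `|t| -> `|df x| <= K) -> `|f t - f 0| <= K * `|t|.
Proof.
wlog t0 : f df t / 0 <= t.
  move=> wl fd dfK; have [t0|/ltW t0] := leP 0 t; first exact: (wl f df).
  have := wl _ _ (- t) _ (is_derive_reflect fd).
  rewrite opprK oppr0 normrN; apply; first by rewrite oppr_ge0.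
  by move=> x xt; rewrite normrN; apply: dfK; rewrite normrN.
move=> fd dfK; have [c cI ->] := MVT_everywhere fd t0.
rewrite subr0 normrM ler_wpM2r// dfK//.
by move: cI; rewrite in_itv/= => /andP[c0 ct]; rewrite !ger0_norm.
Qed.

(** The mean value bound, applied to f minus its tangent at 0. *)
Lemma quadratic_bound f df (K t : R) :
  (forall t, is_derive t (1 : R) f (df t)) ->
  (forall x, `|x| <= `|t| -> `|df x - df 0| <= K * `|x|) ->
  `|f t - f 0 - t * df 0| <= K * `|t| ^+ 2.
Proof.
move=> fd dfK.
have gd x : is_derive x (1 : R) (fun x => f x - x * df 0) (df x - df 0).
  have H := is_deriveB (fd x) (is_deriveM (is_derive_id x 1) (is_derive_cst (df 0) x 1)).
  by apply: (is_derive_eq H); rewrite /= scaler0 add0r scaler1.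
have K0 : 0 <= K * `|t| by apply: le_trans (dfK t _).
have := mean_value_bound gd (K := K * `|t|) (t := t).
rewrite mul0r subr0 addrAC expr2 mulrA; apply => x xt.
have [t0|t0] := eqVneq t 0.
  move: (xt); rewrite t0 normr0 normr_le0 => /eqP->.
  by rewrite subrr normr0 mulr0.
apply: le_trans (dfK x xt) _; apply: ler_wpM2l => //.
by move: K0; rewrite pmulr_lge0// normr_gt0.
Qed.

(** The function [exp (- A t) (f t + b / A)] has derivative
    [exp (- A t) (f' - A f - b)], which is nonpositive for t in [0, T]. *)
Lemma gronwall f df (A b T t : R) :
  (forall t, is_derive t (1 : R) f (df t)) -> 0 < A ->
  (forall x, `|x| <= T -> `|df x| <= A * f x + b) -> `|t| <= T ->
  f t + b / A <= expR (A * `|t|) * (f 0 + b / A).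
Proof.
wlog t0 : f df t / 0 <= t.
  move=> wl fd A0 dfA tT; have [t0|/ltW t0] := leP 0 t; first exact: (wl f df).
  have := wl _ _ (- t) _ (is_derive_reflect fd) A0.
  rewrite opprK oppr0 normrN; apply => //; first by rewrite oppr_ge0.
  by move=> x xT; rewrite normrN; apply: dfA; rewrite normrN.
move=> fd A0 dfA; rewrite (ger0_norm t0) => tT.
pose g x := expR (- A * x) * (f x + b / A).
have gd x : is_derive x (1 : R) g (expR (- A * x) * (df x - A * f x - b)).
  have H1 := is_derive1_comp (is_derive_expR (- A * x)) (is_deriveZ (- A) (is_derive_id x 1)).
  have H2 := is_deriveD (fd x) (is_derive_cst (b / A) x 1).
  apply: (is_derive_eq (is_deriveM H1 H2)).
  rewrite /= /cst /comp /GRing.scale /= !fctE; field; exact: lt0r_neq0.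
have [c cI gE] := MVT_everywhere gd t0.
have : g t <= g 0.
  rewrite -subr_le0 gE subr0 mulr_le0_ge0// mulr_ge0_le0 ?expR_ge0//.
  rewrite in_itv/= in cI; case/andP: cI => c0 ct.
  have := dfA c; rewrite (ger0_norm c0) (le_trans ct tT) => /(_ isT).
  by move=> /(le_trans (ler_norm _)); rewrite -[_ - b]addrA -opprD subr_le0.
rewrite /g mulr0 expR0 mul1r mulNr expRN => H.
by rewrite -(ler_pdivrMl _ _ (expR_gt0 _)).
Qed.

Lemma expR_quadratic (t : R) : `|expR t - 1 - t| <= t ^+ 2 * expR `|t|.
Proof.
have fd x : is_derive x (1 : R) expR (expR x) by exact: is_derive_expR.
have K x : `|x| <= `|t| -> `|expR x| <= expR `|t|.
  by move=> xt; rewrite ger0_norm ?expR_ge0// ler_expR (le_trans (ler_norm x)).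
have := quadratic_bound fd (K := expR `|t|) (t := t).
rewrite expR0 mulr1 real_normK ?num_real// [_ * t ^+ 2]mulrC; apply=> x xt.
rewrite -expR0; apply: mean_value_bound => // y yx; apply: K; exact: le_trans yx xt.
Qed.

Lemma continuous_bounded_itv f (T : R) : continuous f ->
  exists M, forall t, `|t| <= T -> `|f t| <= M.
Proof.
move=> fc; have [T0|T0] := leP 0 T; last first.
  by exists 0 => t tT; move: (le_lt_trans tT T0); rewrite ltNge normr_ge0.
have [||c _ cM] := @EVT_max R (fun x => `|f x|) (- T) T.
  - by rewrite (le_trans _ T0)// oppr_le0.
  - apply: continuous_subspaceT => x.
    by apply: (@continuous_comp _ _ _ f Num.norm); [exact: fc|exact: norm_continuous].
by exists `|f c| => t tT; apply: cM; rewrite in_itv/= -ler_norml.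
Qed.

End RealLine.

(** * The sup norm and exponential polynomials *)

Section SupNorm.
Context {R : realType}.

(** Entries control the norm of a row vector and conversely, which reduces
    estimates on vector-valued functions to real-valued ones. *)
Lemma norm_entry n (x : 'rV[R]_n) i : `|x 0 i| <= `|x|.
Proof.
by rewrite [leRHS]/Num.Def.normr/= mx_normrE; exact: (le_bigmax _ _ (0, i)).
Qed.

Lemma norm_le_entries n (x : 'rV[R]_n) (c : R) :
  0 <= c -> (forall i, `|x 0 i| <= c) -> `|x| <= c.
Proof.
move=> c0 xc; rewrite [leLHS]/Num.Def.normr/= mx_normrE bigmax_le// => -[i j] _.
by rewrite ord1 xc.
Qed.

Lemma uniform_bound n (P : 'I_n -> R -> Prop) :
  (forall i c c', c <= c' -> P i c -> P i c') ->
  (forall i, exists c, P i c) -> exists2 c, 0 <= c & forall i, P i c.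
Proof.
move=> Pmono /choice[c Pc]; exists (\sum_i `|c i|); first exact: sumr_ge0.
move=> i; apply: Pmono (Pc i); rewrite (le_trans (ler_norm _))//.
by rewrite (bigD1 i)//= lerDl sumr_ge0.
Qed.

End SupNorm.

(** How a first order expansion with quadratic error yields a Lipschitz bound:
    a is the base value, b the new one and c the value of the differential. *)
Lemma increment_bound {R : realType} {V : normedZmodType R} (C M e : R)
    (a b c : V) :
  0 <= e -> 0 <= C -> e <= M ->
  `|c| <= C * e -> `|b - a - c| <= C * e ^+ 2 -> `|b - a| <= C * (1 + M) * e.
Proof.
move=> e0 C0 eM hc hr; rewrite -[b - a](subrK c) (le_trans (ler_normD _ _))//.
rewrite (le_trans (lerD hr hc))// (_ : C * e ^+ 2 + C * e = C * (e + 1) * e); last by ring.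
by rewrite ler_wpM2r// ler_wpM2l// [leRHS]addrC lerD2r.
Qed.

Section ExponentialPolynomials.
Context {R : realType} {n : nat}.
Local Notation V := 'rV[R]_n.

(** Exponential polynomials in the coordinates, each with its differential.
    Carrying the differential along gives, by induction on the way the function
    is built, everything that is needed of it: linearity, the chain rule, uniform
    second order expansions on bounded sets, and stability of the class. *)
Inductive expoly : (V -> R) -> (V -> V -> R) -> Prop :=
| expoly_cst c : expoly (fun=> c) (fun _ _ => 0)
| expoly_coord i : expoly (fun x => x 0 i) (fun _ w => w 0 i)
| expolyD F DF G DG : expoly F DF -> expoly G DG ->
    expoly (fun x => F x + G x) (fun x w => DF x w + DG x w)
| expolyM F DF G DG : expoly F DF -> expoly G DG ->
    expoly (fun x => F x * G x) (fun x w => DF x w * G x + F x * DG x w)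
| expoly_exp F DF : expoly F DF ->
    expoly (fun x => expR (F x)) (fun x w => DF x w * expR (F x)).

Lemma expoly_eq F DF G DG :
  expoly F DF -> F =1 G -> DF =2 DG -> expoly G DG.
Proof.
move=> FDF /funext <- FG; rewrite (_ : DG = DF)//.
by apply/funext => x; apply/funext => w.
Qed.

Lemma expolyN F DF :
  expoly F DF -> expoly (fun x => - F x) (fun x w => - DF x w).
Proof.
move=> FDF; apply: expoly_eq (expolyM (expoly_cst (-1)) FDF) _ _.
  by move=> x; rewrite mulN1r.
by move=> x w; rewrite mul0r add0r mulN1r.
Qed.

Lemma expoly_linear F DF : expoly F DF ->
  forall x (a : R) w w', DF x (a *: w + w') = a * DF x w + DF x w'.
Proof.
elim=> [c|i|{}F {}DF G DG _ IF _ IG|{}F {}DF G DG _ IF _ IG|{}F {}DF _ IF] x a w w'.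
- by rewrite mulr0 addr0.
- by rewrite !mxE.
- by rewrite IF IG; ring.
- by rewrite IF IG; ring.
- by rewrite IF; ring.
Qed.

Lemma expoly_curve F DF (y : R -> V) (dy : V) t : expoly F DF ->
  (forall i, is_derive t (1 : R) (fun t => y t 0 i) (dy 0 i)) ->
  is_derive t (1 : R) (fun t => F (y t)) (DF (y t) dy).
Proof.
move=> FDF yd.
elim: FDF => [c|i|{}F {}DF G DG _ IF _ IG|{}F {}DF G DG _ IF _ IG|{}F {}DF _ IF].
- exact: is_derive_cst.
- exact: yd.
- exact: is_deriveD.
- apply: (is_derive_eq (is_deriveM IF IG)).
  by rewrite /GRing.scale/= addrC mulrC.
- apply: (is_derive_eq (is_derive1_comp (is_derive_expR _) IF)).
  by rewrite /GRing.scale/= mulrC.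
Qed.

(** The derivative of an exponential polynomial along a field of the same kind
    is of the same kind: this is what makes smoothness a plain induction. *)
Lemma expoly_along F DF (Z : V -> V) : expoly F DF ->
  (forall i, exists DZ, expoly (fun x => Z x 0 i) DZ) ->
  exists D, expoly (fun x => DF x (Z x)) D.
Proof.
move=> FDF hZ.
elim: FDF => [c|i|{}F {}DF G DG eF [D1 h1] eG [D2 h2]
  |{}F {}DF G DG eF [D1 h1] eG [D2 h2]|{}F {}DF eF [D1 h1]].
- by eexists; exact: expoly_cst.
- exact: hZ.
- by eexists; apply: expolyD h1 h2.
- by eexists; apply: expolyD (expolyM h1 eG) (expolyM eF h2).
- by eexists; apply: expolyM h1 (expoly_exp eF).
Qed.

(** The second order expansion, uniform on a ball.  In the cases of products and
    exponentials, the increment of a factor is bounded by [increment_bound]. *)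
Lemma expoly_taylor F DF (M : R) : expoly F DF ->
  exists2 C, 0 <= C & forall x w : V, `|x| <= M -> `|w| <= M ->
    [/\ `|F x| <= C, `|DF x w| <= C * `|w|
      & `|F (x + w) - F x - DF x w| <= C * `|w| ^+ 2].
Proof.
have [M0|M0] := leP 0 M; last first.
  by exists 0 => // x w xM; move: (le_lt_trans xM M0); rewrite ltNge normr_ge0.
elim=> [c|i|{}F {}DF G DG _ [C C0 IF] _ [D D0 IG]
  |{}F {}DF G DG _ [C C0 IF] _ [D D0 IG]|{}F {}DF _ [C C0 IF]].
- exists `|c| => // x w _ _; rewrite subrr subr0 normr0.
  by split=> //; rewrite mulr_ge0// exprn_ge0.
- exists (M + 1) => [|x w xM wM]; first by rewrite addr_ge0.
  split; first by rewrite (le_trans (norm_entry _ _))// (le_trans xM)// lerDl.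
    by rewrite (le_trans (norm_entry _ _))// ler_peMl// lerDr.
  by rewrite mxE addrAC addrK subrr normr0 mulr_ge0 ?addr_ge0// exprn_ge0.
- exists (C + D) => [|x w xM wM]; first exact: addr_ge0.
  have [F1 F2 F3] := IF x w xM wM; have [G1 G2 G3] := IG x w xM wM.
  rewrite !mulrDl (_ : F (x + w) + _ - _ - _ =
    (F (x + w) - F x - DF x w) + (G (x + w) - G x - DG x w)); last by ring.
  by split; apply: (le_trans (ler_normD _ _)); apply: lerD.
- exists (C * D * (3 + 2 * M + M ^+ 2)) => [|x w xM wM].
    by rewrite !mulr_ge0// !addr_ge0// ?mulr_ge0// exprn_ge0.
  have [F1 F2 F3] := IF x w xM wM; have [G1 G2 G3] := IG x w xM wM.
  have G4 := increment_bound (normr_ge0 w) D0 wM G2 G3.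
  have G5 : `|G (x + w)| <= D * (1 + (1 + M) * M).
    rewrite -[G _](subrK (G x)) (le_trans (ler_normD _ _))// mulrDr mulr1 addrC.
    rewrite lerD// mulrA (le_trans G4)// ler_wpM2l ?mulr_ge0 ?addr_ge0//.
  have CD0 : 0 <= C * D by exact: mulr_ge0.
  split.
  + rewrite normrM -[leLHS]mulr1 ler_pM ?mulr_ge0//.
      by rewrite ler_pM.
    by nra.
  + apply: (le_trans (ler_normD _ _)); rewrite !normrM.
    apply: (@le_trans _ _ (C * `|w| * D + C * (D * `|w|))).
      by rewrite lerD// ler_pM.
    rewrite (_ : _ + _ = C * D * 2 * `|w|); last by ring.
    by rewrite ler_wpM2r// ler_wpM2l//; nra.
  + rewrite (_ : F (x + w) * _ - _ - _ =
      (F (x + w) - F x - DF x w) * G (x + w) + DF x w * (G (x + w) - G x)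
      + F x * (G (x + w) - G x - DG x w)); last by ring.
    apply: (le_trans (ler_normD _ _)).
    apply: (le_trans (lerD (ler_normD _ _) (lexx _))); rewrite !normrM.
    apply: (@le_trans _ _ (C * `|w| ^+ 2 * (D * (1 + (1 + M) * M))
        + C * `|w| * (D * (1 + M) * `|w|) + C * (D * `|w| ^+ 2))).
      by rewrite !lerD// ler_pM.
    by rewrite le_eqVlt; apply/orP; left; apply/eqP; ring.
- pose L := C * (1 + M).
  have L0 : 0 <= L by rewrite mulr_ge0 ?addr_ge0.
  pose K := 1 + C + L ^+ 2 * expR (L * M).
  have LK0 : 0 <= L ^+ 2 * expR (L * M) by rewrite mulr_ge0 ?exprn_ge0 ?expR_ge0.
  have K1 : 1 <= K by rewrite /K; lra.
  have KC : C <= K by rewrite /K; lra.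
  have e0 := @expR_ge0 R.
  exists (expR C * K) => [|x w xM wM]; first by rewrite mulr_ge0//; lra.
  have [F1 F2 F3] := IF x w xM wM.
  have F4 := increment_bound (normr_ge0 w) C0 wM F2 F3.
  have F5 : `|expR (F x)| <= expR C.
    by rewrite ger0_norm// ler_expR (le_trans (ler_norm _)).
  split.
  + by rewrite (le_trans F5)// ler_peMr.
  + rewrite normrM mulrC -mulrA ler_pM// (le_trans F2)// ler_wpM2r//.
  + set d := F (x + w) - F x in F3 F4.
    rewrite (_ : _ - _ - _ = expR (F x) * ((expR d - 1 - d) + (d - DF x w))).
      rewrite normrM -mulrA ler_pM// (le_trans (ler_normD _ _))//.
      rewrite /K [in leRHS]addrC mulrDl lerD//.
        rewrite (le_trans (expR_quadratic d))// [leRHS]mulrAC -exprMn.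
        rewrite -real_normK ?num_real// ler_pM ?exprn_ge0//.
          have Lw : 0 <= L * `|w| by rewrite mulr_ge0.
          by rewrite ler_sqr ?nnegrE.
        rewrite ler_expR (le_trans F4)//; exact: ler_wpM2l.
      by rewrite (le_trans F3)// ler_wpM2r ?exprn_ge0// lerDr.
    rewrite -[F (x + w)](subrK (F x)) -/d expRD; ring.
Qed.

End ExponentialPolynomials.

(** * Differentials and integral curves *)

(** A quadratic error is a little-o of the increment; the bound on L makes the
    candidate differential continuous. *)
Lemma is_diff_quadratic {R : realType} {V W : normedModType R} (f L : V -> W)
    w (C : R) : linear L ->
  (forall X, `|X| <= 1 ->
     `|L X| <= C * `|X| /\ `|f (w + X) - f w - L X| <= C * `|X| ^+ 2) ->
  is_diff w f L.
Proof.
move=> Llin fL.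
pose M := GRing.isLinear.Build _ _ _ _ _ Llin.
pose Ll : {linear V -> W} := HB.pack L M.
have Lc : continuous Ll.
  apply/linear_bounded_continuous/ex_bound; exists `|C|; near=> X.
  have X1 : `|X| <= 1 by near: X; exact: nbhs0_le.
  apply: (le_trans (fL X X1).1); rewrite (le_trans (ler_norm _))// normrM.
  by rewrite normr_id ler_piMr.
have E : f \o shift w = cst (f w) + Ll +o_ 0 id.
  apply/eqaddoP => e e0; pose c := `|C| + 1.
  have c0 : 0 < c by rewrite ltr_wpDl.
  near=> X; have X1 : `|X| <= 1 by near: X; exact: nbhs0_le.
  rewrite !fctE /= opprD addrA [X + w]addrC.
  apply: (le_trans (fL X X1).2); rewrite expr2 mulrA ler_wpM2r//.
  apply: (@le_trans _ _ (c * `|X|)).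
    by rewrite ler_wpM2r// (le_trans (ler_norm _))// lerDl.
  rewrite mulrC -ler_pdivlMr//; near: X; apply: nbhs0_le; exact: divr_gt0.
have dE := diff_unique Lc E.
by split; [apply/diff_locallyP; rewrite dE|].
Unshelve. all: by end_near. Qed.

Section VectorValued.
Context {R : realType}.

Definition expolyv n m (F : 'rV[R]_n -> 'rV[R]_m)
    (DF : 'rV[R]_n -> 'rV[R]_n -> 'rV[R]_m) : Prop :=
  forall j, expoly (fun x => F x 0 j) (fun x w => DF x w 0 j).

(** Stated on entries, where the real-variable lemmas apply. *)
Definition integral_curve n (Z : 'rV[R]_n -> 'rV[R]_n) (y : R -> 'rV[R]_n) :=
  forall t i, is_derive t (1 : R) (fun t => y t 0 i) (Z (y t) 0 i).

Lemma expolyv_linear n m F DF : @expolyv n m F DF -> forall x, linear (DF x).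
Proof.
move=> FDF x a w w'; apply/rowP => j.
by rewrite (expoly_linear (FDF j)) !mxE.
Qed.

Lemma expolyv_taylor n m F DF (M : R) : @expolyv n m F DF ->
  exists2 C, 0 <= C & forall x w, `|x| <= M -> `|w| <= M ->
    [/\ `|F x| <= C, `|DF x w| <= C * `|w|
      & `|F (x + w) - F x - DF x w| <= C * `|w| ^+ 2].
Proof.
move=> FDF.
have [||C C0 FC] := @uniform_bound R m (fun j C => 0 <= C /\
    forall x w : 'rV[R]_n, `|x| <= M -> `|w| <= M ->
    [/\ `|F x 0 j| <= C, `|DF x w 0 j| <= C * `|w|
      & `|F (x + w) 0 j - F x 0 j - DF x w 0 j| <= C * `|w| ^+ 2]).
- move=> i c c' cc' [c0 H]; split=> [|x w xM wM]; first exact: le_trans cc'.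
  have [H1 H2 H3] := H x w xM wM.
  split; [exact: le_trans cc'|apply: le_trans H2 _|apply: le_trans H3 _];
    by rewrite ler_wpM2r ?exprn_ge0.
- by move=> j; have [C C0 H] := expoly_taylor M (FDF j); exists C.
exists C => // x w xM wM; split; apply: norm_le_entries => //.
- by move=> j; have [_ /(_ x w xM wM)[]] := FC j.
- by rewrite mulr_ge0.
- by move=> j; have [_ /(_ x w xM wM)[]] := FC j.
- by rewrite mulr_ge0// exprn_ge0.
- by move=> j; rewrite !mxE; have [_ /(_ x w xM wM)[]] := FC j.
Qed.

Lemma expolyv_lipschitz n m F DF (M : R) : @expolyv n m F DF ->
  exists2 L, 0 <= L & forall x y, `|x| <= M -> `|y| <= M ->
    `|F y - F x| <= L * `|y - x|.
Proof.
have [M0|M0] := leP 0 M; last first.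
  by exists 0 => // x y xM; move: (le_lt_trans xM M0); rewrite ltNge normr_ge0.
move=> /(expolyv_taylor (M + M))[C C0 H].
exists (C * (1 + (M + M))) => [|x y xM yM]; first by rewrite mulr_ge0 ?addr_ge0.
have xyM : `|y - x| <= M + M by apply: le_trans (ler_normB _ _) (lerD yM xM).
have xMM : `|x| <= M + M by rewrite (le_trans xM)// lerDl.
have [_ H2 H3] := H x (y - x) xMM xyM; move: H3; rewrite subrKC => H3.
exact: increment_bound C0 xyM H2 H3.
Qed.

Lemma expolyv_is_diff n m F DF x : @expolyv n m F DF -> is_diff x F (DF x).
Proof.
move=> FDF; have [C C0 H] := expolyv_taylor (`|x| + 1) FDF.
apply: (is_diff_quadratic (C := C)); first exact: expolyv_linear FDF x.
move=> X X1; have [||_ H2 H3] := H x X; last by split.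
  by rewrite lerDl.
by rewrite (le_trans X1)// lerDr.
Qed.

Lemma is_derive_integral_curve n (Z : 'rV[R]_n -> 'rV[R]_n) y :
  (forall t, is_derive t (1 : R) y (Z (y t))) -> integral_curve Z y.
Proof.
move=> yd t i; have [/derivable_mxP yt <-] := yd t.
by split; [exact: yt|rewrite derive_mx ?mxE//; apply/derivable_mxP].
Qed.

Lemma integral_curve_shift n (Z : 'rV[R]_n -> 'rV[R]_n) y (a : R) :
  integral_curve Z y -> integral_curve Z (fun t => y (a + t)).
Proof.
move=> yd t i.
have H := is_deriveD (is_derive_cst a t 1) (is_derive_id t 1).
apply: (is_derive_eq (is_derive1_comp (yd _ i) H)).
by rewrite add0r; exact: mulr1.
Qed.

(** Along a curve that stays in a ball, the velocity is bounded, hence the curve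
    is Lipschitz, hence the velocity varies by O(|t|).  The constant depends on the
    ball and not on the curve. *)
Lemma integral_curve_expansion n (Z : 'rV[R]_n -> 'rV[R]_n) DZ (M : R) :
  expolyv Z DZ -> exists2 C, 0 <= C & forall (y : R -> 'rV[R]_n) T,
    integral_curve Z y -> (forall t, `|t| <= T -> `|y t| <= M) ->
    forall t, `|t| <= T -> `|y t - y 0| <= C * `|t| /\
      `|y t - y 0 - t *: Z (y 0)| <= C * `|t| ^+ 2.
Proof.
move=> eZ; have [C C0 HC] := expolyv_taylor M eZ.
have [L L0 HL] := expolyv_lipschitz M eZ.
exists (C + L * C) => [|y T yZ yM t tT]; first by rewrite addr_ge0// mulr_ge0.
have yZC x i : `|x| <= T -> `|Z (y x) 0 i| <= C.
  move=> xT; have M0 : `|0 : 'rV[R]_n| <= M.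
    by rewrite normr0 (le_trans _ (yM _ xT)).
  by have [ZC _ _] := HC (y x) 0 (yM _ xT) M0; exact: le_trans (norm_entry _ i) ZC.
have y1 x : `|x| <= T -> `|y x - y 0| <= C * `|x|.
  move=> xT; apply: norm_le_entries => [|i]; first by rewrite mulr_ge0.
  rewrite !mxE; apply: (mean_value_bound (yZ^~ i)) => s sx.
  by apply: yZC; rewrite (le_trans sx xT).
have T0 : `|0 : R| <= T by rewrite normr0 (le_trans _ tT).
split; first by rewrite (le_trans (y1 _ tT))// ler_wpM2r// lerDl mulr_ge0.
apply: (@le_trans _ _ (L * C * `|t| ^+ 2)); last first.
  by rewrite ler_wpM2r ?exprn_ge0// lerDr.
apply: norm_le_entries => [|i]; first by rewrite !mulr_ge0// exprn_ge0.
rewrite !mxE; apply: (quadratic_bound (yZ^~ i)) => s st.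
have sT := le_trans st tT; have := norm_entry (Z (y s) - Z (y 0)) i.
rewrite !mxE => /le_trans; apply.
by rewrite (le_trans (HL _ _ (yM _ T0) (yM _ sT)))// -mulrA ler_wpM2l// y1.
Qed.

End VectorValued.

(** * Commuting flows *)

Lemma sum_le_const {R : realType} n (F : 'I_n -> R) c :
  (forall i, F i <= c) -> \sum_i F i <= n%:R * c.
Proof.
move=> Fc; apply: (le_trans (ler_sum _ (fun i _ => Fc i))).
by rewrite sumr_const card_ord mulr_natl.
Qed.

Section CommutingFlows.
Context {R : realType} {n : nat}.
Local Notation V := 'rV[R]_n.
Variables (Z W : V -> V) (DZ DW : V -> V -> V).
Hypothesis eZ : expolyv Z DZ.
Hypothesis eW : expolyv W DW.
Hypothesis ZW : forall x, DZ x (W x) = DW x (Z x).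
Variable y : R -> R -> V.
Hypothesis yZ : forall v, integral_curve Z (y ^~ v).
Hypothesis yW : integral_curve W (y 0).
Hypothesis y_bounded : forall T, exists M, forall u v,
  `|u| <= T -> `|v| <= T -> `|y u v| <= M.

(** The heart of the proof.  Fix v and h and let
    d(u) = y(u, v + h) - y(u, v) - h W(y(u, v)).
    Its derivative in u is Z(y(u, v + h)) - Z(y(u, v)) - h DW(Z), and replacing
    DW(Z) by DZ(W) this is at most L |d| + Q h^2, by the Lipschitz property of Z
    and its second order expansion at y(u, v).  At u = 0 the vector d is O(h^2)
    because y(0, .) is an integral curve of W.  Gronwall's inequality, applied to
    the squared Euclidean norm E of d, propagates this to all u in [-T, T]. *)
Lemma transported_expansion (T : R) : exists C, forall u v h,
  `|u| <= T -> `|v| <= T -> `|h| <= 1 ->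
  `|y u (v + h) - y u v - h *: W (y u v)| <= C * h ^+ 2.
Proof.
have [T0|T0] := leP 0 T; last first.
  by exists 0 => u v h uT; move: (le_lt_trans uT T0); rewrite ltNge normr_ge0.
have [M yM] := y_bounded (T + 1).
have M0 : 0 <= M.
  by rewrite (le_trans _ (yM 0 0 _ _))// normr0 addr_ge0.
have [CW CW0 HW] := expolyv_taylor M eW.
pose M2 := M + CW.
have [CZ CZ0 HZ] := expolyv_taylor M2 eZ.
have [L L0 HL] := expolyv_lipschitz M2 eZ.
have [C C0 HC] := integral_curve_expansion M eW.
pose Q := CZ * CW ^+ 2.
have Q0 : 0 <= Q by rewrite mulr_ge0// exprn_ge0.
pose A := n%:R * (2 * L + 1) + 1.
have A0 : 0 < A by rewrite ltr_wpDl// mulr_ge0// addr_ge0// mulr_ge0.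
pose K := expR (A * T) * (n%:R * C ^+ 2 + n%:R * Q ^+ 2 / A).
have K0 : 0 <= K.
  by rewrite mulr_ge0 ?expR_ge0// addr_ge0 ?divr_ge0 ?mulr_ge0 ?exprn_ge0// ltW.
exists (Num.sqrt K) => u v h uT vT h1.
have T1 : T <= T + 1 by rewrite lerDl.
have vhT : `|v + h| <= T + 1 by rewrite (le_trans (ler_normD _ _))// lerD.
have MM2 : M <= M2 by rewrite lerDl.
have vT1 := le_trans vT T1.
pose d t := y t (v + h) - y t v - h *: W (y t v).
pose d' t := Z (y t (v + h)) - Z (y t v) - h *: DW (y t v) (Z (y t v)).
have hd t i : is_derive t (1 : R) (fun t => d t 0 i) (d' t 0 i).
  have H1 := is_deriveB (yZ (v + h) t i) (yZ v t i).
  have H2 := expoly_curve (eW i) (yZ v t).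
  have H3 := is_deriveB H1 (is_deriveZ h H2).
  rewrite /d' !mxE (_ : (fun _ => _) = (fun t => y t (v + h) 0 i)
    - (fun t => y t v 0 i) - h *: (fun t => W (y t v) 0 i)) //.
  by apply/funext => s; rewrite /d !mxE.
have d'_le t : `|t| <= T -> `|d' t| <= L * `|d t| + Q * h ^+ 2.
  move=> tT; have tT1 := le_trans tT T1.
  set x := y t v; set q := x + h *: W x.
  have xM : `|x| <= M by exact: yM.
  have [|W1 _ _] := HW x 0 xM; first by rewrite normr0.
  have hW1 : `|h *: W x| <= `|h| * CW by rewrite normrZ ler_wpM2l.
  have hWC : `|h *: W x| <= CW.
    by rewrite (le_trans hW1)// ler_piMl.
  have hWM2 : `|h *: W x| <= M2 by rewrite (le_trans hWC)// lerDr.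
  have xM2 := le_trans xM MM2.
  have qM2 : `|q| <= M2 by rewrite (le_trans (ler_normD _ _))// lerD.
  have yM2 := le_trans (yM t (v + h) tT1 vhT) MM2.
  have [_ _ HZ3] := HZ x (h *: W x) xM2 hWM2.
  have lin : DZ x (h *: W x) = h *: DW x (Z x).
    have := expolyv_linear eZ x h (W x) 0.
    rewrite addr0 => ->; rewrite ZW -[RHS]addr0; congr (_ + _).
    have := expolyv_linear eZ x (-1) 0 0.
    by rewrite scaler0 addr0 scaleN1r addNr.
  rewrite (_ : d' t = (Z (y t (v + h)) - Z q)
      + (Z q - Z x - DZ x (h *: W x))); last first.
    by rewrite lin /d' -/x !addrA subrK.
  rewrite (le_trans (ler_normD _ _))// lerD//.
    by rewrite (le_trans (HL _ _ qM2 yM2))// /d -/x /q opprD addrA.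
  rewrite (le_trans HZ3)// -mulrA ler_wpM2l// -[h ^+ 2]real_normK ?num_real//.
  by rewrite -exprMn ler_sqr ?nnegrE ?mulr_ge0// mulrC.
(* The sup norm is not differentiable, but it is at most sqrt E. *)
pose E t := \sum_i (d t 0 i) ^+ 2.
have Ege t : 0 <= E t by apply: sumr_ge0 => i _; exact: sqr_ge0.
have dE t : `|d t| ^+ 2 <= E t.
  rewrite -[E t](sqr_sqrtr (Ege t)) ler_sqr ?nnegrE ?sqrtr_ge0//.
  apply: norm_le_entries => [|i]; first exact: sqrtr_ge0.
  rewrite -sqrtr_sqr ler_sqrt ?Ege// /E (bigD1 i)//= lerDl.
  by apply: sumr_ge0 => j _; exact: sqr_ge0.
pose E' t := \sum_i (d t 0 i * d' t 0 i *+ 2).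
have hE t : is_derive t (1 : R) E (E' t).
  have := is_derive_sum (fun i => is_deriveM (hd t i) (hd t i)).
  rewrite (_ : \sum_(i < n) _ = E); last first.
    by apply/funext => s; rewrite /E fct_sumE; apply: eq_bigr => i _; rewrite expr2.
  move=> H; apply: (is_derive_eq H); apply: eq_bigr => i _.
  by rewrite /GRing.scale/= mulr2n.
have E'E t : `|t| <= T -> `|E' t| <= A * E t + n%:R * Q ^+ 2 * h ^+ 4.
  move=> tT; apply: (@le_trans _ _ (n%:R * (2 * `|d t| * `|d' t|))).
    rewrite (le_trans (ler_norm_sum _ _ _))//.
    apply: sum_le_const => i; rewrite normrMn normrM -mulrA [leRHS]mulr_natl.
    by rewrite lerMn2r ler_pM// norm_entry.
  have D0 := normr_ge0 (d t); have := d'_le t tT; have := dE t.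
  set D := `|d t| in D0 *; set D' := `|d' t|; set e := E t => De D'le.
  have h4 : h ^+ 4 = (h ^+ 2) ^+ 2 by rewrite -exprM.
  have n0 : 0 <= n%:R :> R by [].
  rewrite h4; set k := h ^+ 2 in D'le *.
  rewrite /A (_ : _ + n%:R * _ * _ =
    n%:R * ((2 * L + 1) * e + Q ^+ 2 * k ^+ 2) + e); last by ring.
  have e0 : 0 <= e by rewrite (le_trans _ De)// exprn_ge0.
  rewrite -[leLHS]addr0 lerD// ler_wpM2l//.
  (* 2 D Q k is at most D^2 + (Q k)^2. *)
have sq : 0 <= (D - Q * k) ^+ 2 by exact: sqr_ge0.
  apply: (@le_trans _ _ ((2 * L + 1) * D ^+ 2 + Q ^+ 2 * k ^+ 2)); last first.
    by rewrite lerD2r ler_wpM2l// addr_ge0// mulr_ge0.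
  by nra.
have E0 : E 0 <= n%:R * C ^+ 2 * h ^+ 4.
  have vv t : `|t| <= `|h| -> `|y 0 (v + t)| <= M.
    move=> th; apply: yM; first by rewrite normr0 addr_ge0.
    by rewrite (le_trans (ler_normD _ _))// lerD// (le_trans th).
  have [_] := HC _ _ (integral_curve_shift v yW) vv h (lexx _).
  rewrite addr0 -/(d 0) => dC.
  rewrite -mulrA; apply: sum_le_const => i.
  rewrite -real_normK ?num_real// (_ : h ^+ 4 = (`|h| ^+ 2) ^+ 2).
    rewrite -exprMn ler_sqr ?nnegrE ?mulr_ge0 ?exprn_ge0//.
    exact: le_trans (norm_entry _ _) dC.
  by rewrite real_normK ?num_real// -exprM.
have h4 : 0 <= h ^+ 4 by rewrite -[4%N]/(2 * 2)%N exprM exprn_ge0// sqr_ge0.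
have S0 : 0 <= n%:R * Q ^+ 2 * h ^+ 4 / A.
  by rewrite divr_ge0 ?(ltW A0)// mulr_ge0// mulr_ge0// exprn_ge0.
have Eu : E u <= K * h ^+ 4.
  have G := gronwall hE A0 E'E uT.
  apply: (@le_trans _ _ (expR (A * `|u|) * (E 0 + n%:R * Q ^+ 2 * h ^+ 4 / A))).
    by apply: le_trans G; rewrite lerDl.
  rewrite /K -[leRHS]mulrA; apply: ler_pM.
  - exact: expR_ge0.
  - exact: addr_ge0.
  - by rewrite ler_expR ler_wpM2l// ltW.
  - by rewrite mulrDl lerD// mulrAC.
have R0 : 0 <= Num.sqrt K * h ^+ 2 by rewrite mulr_ge0 ?sqrtr_ge0 ?sqr_ge0.
rewrite -ler_sqr ?nnegrE// exprMn sqr_sqrtr// -exprM.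
exact: le_trans (dE u) Eu.
Qed.

(** Moving from (u, v) to (u + k, v + h) first in u and then in v, the errors are
    O(k^2) along Z, O(h^2) along W uniformly in the new u, and h times the change
    of W between the two base points, which is O(k). *)
Lemma commuting_flows_is_diff w :
  is_diff w (fun w : 'rV[R]_2 => y (w 0 0) (w 0 1))
    (fun X : 'rV[R]_2 => X 0 0 *: Z (y (w 0 0) (w 0 1))
                       + X 0 1 *: W (y (w 0 0) (w 0 1))).
Proof.
set u := w 0 0; set v := w 0 1; set x := y u v.
pose T := `|w| + 1.
have [C1 HC1] := transported_expansion T.
have [M yM] := y_bounded T.
have [C2 C20 HC2] := integral_curve_expansion M eZ.
have [L L0 HL] := expolyv_lipschitz M eW.
pose C := (`|C1| + L * C2 + C2) + (`|Z x| + `|W x|).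
have wT : `|w| <= T by rewrite lerDl.
have uT : `|u| <= T by rewrite (le_trans (norm_entry _ _)).
have vT : `|v| <= T by rewrite (le_trans (norm_entry _ _)).
apply: (is_diff_quadratic (C := C)) => [a X Y|X X1].
  by rewrite !mxE !scalerDl !scalerDr !scalerA addrACA.
have := norm_entry X 0; have := norm_entry X 1.
rewrite !mxE -/u -/v; set k := X 0 0; set h := X 0 1 => hX kX.
have e0 := normr_ge0 X; set e := `|X| in X1 hX kX e0 *.
split.
  rewrite (le_trans (ler_normD _ _))// !normrZ.
  apply: (@le_trans _ _ ((`|Z x| + `|W x|) * e)).
    by rewrite mulrDl lerD// mulrC ler_wpM2l.
  by rewrite ler_wpM2r// lerDr !addr_ge0// mulr_ge0.
have ukT t : `|t| <= `|k| -> `|u + t| <= T.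
  move=> tk; rewrite (le_trans (ler_normD _ _))// lerD ?norm_entry//.
  by rewrite (le_trans tk)// (le_trans kX).
have h1 : `|h| <= 1 by exact: le_trans hX X1.
have H1 := HC1 (u + k) v h (ukT k (lexx _)) vT h1.
have [||H2 H3] := HC2 (fun t => y (u + t) v) `|k| _ _ k (lexx _).
- exact: (integral_curve_shift u (yZ v)).
- by move=> t tk; apply: yM => //; exact: ukT.
rewrite addr0 -/x in H2 H3.
have H4 := HL x (y (u + k) v) (yM _ _ uT vT) (yM _ _ (ukT k (lexx _)) vT).
set a := y (u + k) (v + h) in H1 *; set b := y (u + k) v in H1 H2 H3 H4 *.
(* b is the intermediate point y (u + k) v. *)
rewrite (_ : a - x - _ = (a - b - h *: W b) + h *: (W b - W x)
    + (b - x - k *: Z x)); last first.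
  by apply/rowP => i; rewrite !mxE; ring.
rewrite (le_trans (ler_normD _ _))// (le_trans (lerD (ler_normD _ _) H3))//.
rewrite normrZ; apply: (@le_trans _ _ ((`|C1| + L * C2 + C2) * e ^+ 2)).
  have sqe t : `|t| <= e -> `|t| ^+ 2 <= e ^+ 2.
    by move=> te; rewrite ler_sqr ?nnegrE.
  rewrite !mulrDl !lerD//.
  - rewrite (le_trans H1)// (le_trans (ler_norm _))// normrM normrX.
    by rewrite ler_wpM2l// sqe.
  - rewrite (le_trans (ler_wpM2l (normr_ge0 _) H4))//.
    rewrite mulrCA -mulrA ler_wpM2l//.
    rewrite (le_trans (ler_wpM2l (normr_ge0 _) H2))// mulrCA ler_wpM2l//.
    by rewrite expr2 ler_pM.
  - by rewrite ler_wpM2l// sqe.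
by rewrite ler_wpM2r ?exprn_ge0// lerDl addr_ge0.
Qed.

End CommutingFlows.

(** The derivative of F o phi along v is G o phi, where
    G = v_0 DF(Z) + v_1 DF(W) is again an exponential polynomial. *)
Lemma smooth_expoly_comp {R : realType} n (Z W : 'rV[R]_n -> 'rV[R]_n) DZ DW
    (phi : 'rV[R]_2 -> 'rV[R]_n) m (F : 'rV[R]_n -> 'rV[R]_m) DF :
  expolyv Z DZ -> expolyv W DW ->
  (forall w, is_diff w phi
     (fun X => X 0 0 *: Z (phi w) + X 0 1 *: W (phi w))) ->
  expolyv F DF -> smooth (fun w => F (phi w)).
Proof.
move=> eZ eW dphi + k; elim: k F DF => [|k IHk] F DF eF /=.
  move=> w; have dFphi := is_diff_comp (dphi w) (expolyv_is_diff (phi w) eF).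
  exact/differentiable_continuous/ex_diff.
have dF w := is_diff_comp (dphi w) (expolyv_is_diff (phi w) eF).
split=> [w|v]; first by have [] := dF w.
pose G x := v 0 0 *: DF x (Z x) + v 0 1 *: DF x (W x).
have /choice[DG eG] j : exists DG, expoly (fun x => G x 0 j) DG.
  have [D1 H1] := expoly_along (eF j) (fun i => ex_intro _ _ (eZ i)).
  have [D2 H2] := expoly_along (eF j) (fun i => ex_intro _ _ (eW i)).
  eexists; apply: expoly_eq (expolyD (expolyM (expoly_cst (v 0 0)) H1)
    (expolyM (expoly_cst (v 0 1)) H2)) _ (fun _ _ => erefl).
  by move=> x; rewrite !mxE.
rewrite (_ : (fun w => _) = (fun w => G (phi w))).
  apply: (IHk G (fun x w => \row_j DG j x w)) => j.
  by apply: expoly_eq (eG j) _ _ => // x w; rewrite mxE.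
apply/funext => w; have [dFw dFE] := dF w.
rewrite deriveE// dFE /comp (expolyv_linear eF) /G; congr (_ + _).
by rewrite -[in LHS](addr0 (_ *: W _)) (expolyv_linear eF) (_ : DF _ 0 = 0) ?addr0//;
  have := expolyv_linear eF (phi w) (-1) 0 0; rewrite scaler0 addr0 scaleN1r addNr.
Qed.

(** * The two fields and their bracket *)

Section EuclideanProduct.
Context {R : realType}.

Lemma dotE n (u v : 'rV[R]_n) : dot u v = \sum_j u 0 j * v 0 j.
Proof. by rewrite /dot mxE; apply: eq_bigr => j _; rewrite mxE. Qed.

Lemma dotC n (u v : 'rV[R]_n) : dot u v = dot v u.
Proof. by rewrite !dotE; apply: eq_bigr => j _; rewrite mulrC. Qed.

Lemma dotDl n (u v w : 'rV[R]_n) : dot (u + v) w = dot u w + dot v w.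
Proof. by rewrite /dot mulmxDl mxE. Qed.

Lemma dotDr n (u v w : 'rV[R]_n) : dot u (v + w) = dot u v + dot u w.
Proof. by rewrite dotC dotDl !(dotC u). Qed.

Lemma dotZl n a (u v : 'rV[R]_n) : dot (a *: u) v = a * dot u v.
Proof. by rewrite /dot -scalemxAl mxE. Qed.

Lemma dotZr n a (u v : 'rV[R]_n) : dot u (a *: v) = a * dot u v.
Proof. by rewrite dotC dotZl dotC. Qed.

Lemma dotNl n (u v : 'rV[R]_n) : dot (- u) v = - dot u v.
Proof. by rewrite -scaleN1r dotZl mulN1r. Qed.

Lemma dotNr n (u v : 'rV[R]_n) : dot u (- v) = - dot u v.
Proof. by rewrite dotC dotNl dotC. Qed.

Lemma mxactD n (B : 'M[R]_n) u v : mxact B (u + v) = mxact B u + mxact B v.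
Proof. exact: mulmxDl. Qed.

Lemma mxactZ n (B : 'M[R]_n) a v : mxact B (a *: v) = a *: mxact B v.
Proof. by rewrite /mxact -scalemxAl. Qed.

Lemma mxactN n (B : 'M[R]_n) v : mxact B (- v) = - mxact B v.
Proof. exact: mulNmx. Qed.

Definition dot_linE n := (@dotDl n, @dotDr n, @dotNl n, @dotNr n, @dotZl n,
  @dotZr n, @mxactD n, @mxactN n, @mxactZ n).

Lemma so4_dot (B : 'M[R]_4) u v : so4 B -> dot (mxact B u) v = - dot (mxact B v) u.
Proof.
by move=> hB; rewrite [in RHS]dotC /dot /mxact trmx_mul trmxK hB mulmxN mulNmx
  mxE mulmxA.
Qed.

Lemma so4_dot_diag (B : 'M[R]_4) u : so4 B -> dot (mxact B u) u = 0.
Proof.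
by move=> hB; have := so4_dot u u hB; set d := dot _ _ => dN; lra.
Qed.

End EuclideanProduct.

Section Closure.
Context {R : realType} {n : nat}.
Local Notation V := 'rV[R]_n.

Lemma expoly_sum m (F : 'I_m -> V -> R) DF : (forall i, expoly (F i) (DF i)) ->
  expoly (fun x => \sum_i F i x) (fun x w => \sum_i DF i x w).
Proof.
elim: m F DF => [|m IHm] F DF FDF.
  by apply: expoly_eq (expoly_cst 0) _ _ => [x|x w]; rewrite big_ord0.
apply: expoly_eq (expolyD (FDF ord0) (IHm _ _ (fun i => FDF (lift ord0 i)))) _ _.
  by move=> x; rewrite big_ord_recl.
by move=> x w; rewrite big_ord_recl.
Qed.

Lemma expoly_dot m (F G : V -> 'rV[R]_m) DF DG :
  expolyv F DF -> expolyv G DG ->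
  expoly (fun x => dot (F x) (G x))
    (fun x w => dot (DF x w) (G x) + dot (F x) (DG x w)).
Proof.
move=> eF eG.
apply: expoly_eq (expoly_sum (fun j => expolyM (eF j) (eG j))) _ _ => [x|x w].
  by rewrite dotE.
by rewrite !dotE big_split.
Qed.

Lemma expolyv_eq m (F G : V -> 'rV[R]_m) DF DG :
  expolyv F DF -> F =1 G -> DF =2 DG -> expolyv G DG.
Proof.
move=> eF FG DFG j.
by apply: expoly_eq (eF j) _ _ => [x|x w]; rewrite ?FG ?DFG.
Qed.

Lemma expolyvD m (F G : V -> 'rV[R]_m) DF DG :
  expolyv F DF -> expolyv G DG ->
  expolyv (fun x => F x + G x) (fun x w => DF x w + DG x w).
Proof.
move=> eF eG j.
by apply: expoly_eq (expolyD (eF j) (eG j)) _ _ => [x|x w]; rewrite mxE.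
Qed.

Lemma expolyvN m (F : V -> 'rV[R]_m) DF :
  expolyv F DF -> expolyv (fun x => - F x) (fun x w => - DF x w).
Proof.
by move=> eF j; apply: expoly_eq (expolyN (eF j)) _ _ => [x|x w]; rewrite mxE.
Qed.

Lemma expolyvZ m (f : V -> R) Df (F : V -> 'rV[R]_m) DF :
  expoly f Df -> expolyv F DF ->
  expolyv (fun x => f x *: F x) (fun x w => Df x w *: F x + f x *: DF x w).
Proof.
move=> ef eF j.
by apply: expoly_eq (expolyM ef (eF j)) _ _ => [x|x w]; rewrite !mxE.
Qed.

Lemma expolyv_constZ m (k : R) (F : V -> 'rV[R]_m) DF : expolyv F DF ->
  expolyv (fun x => k *: F x) (fun x w => k *: DF x w).
Proof.
move=> eF j.
by apply: expoly_eq (expolyM (expoly_cst k) (eF j)) _ _ => [x|x w];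
  rewrite !mxE// mul0r add0r.
Qed.

Lemma expolyv_mxact m (B : 'M[R]_m) (F : V -> 'rV[R]_m) DF : expolyv F DF ->
  expolyv (fun x => mxact B (F x)) (fun x w => mxact B (DF x w)).
Proof.
move=> eF j; apply: expoly_eq (expoly_sum (fun k =>
  expolyM (eF k) (expoly_cst (B^T k j)))) _ _ => [x|x w]; rewrite mxE//.
by apply: eq_bigr => k _; rewrite mulr0 addr0.
Qed.

Lemma expolyv_row_mx m1 m2 (F : V -> 'rV[R]_m1) (G : V -> 'rV[R]_m2) DF DG :
  expolyv F DF -> expolyv G DG ->
  expolyv (fun x => row_mx (F x) (G x)) (fun x w => row_mx (DF x w) (DG x w)).
Proof.
move=> eF eG j; case: (split_ordP j) => i ->.
  by apply: expoly_eq (eF i) _ _ => [x|x w]; rewrite row_mxEl.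
by apply: expoly_eq (eG i) _ _ => [x|x w]; rewrite row_mxEr.
Qed.

Lemma expolyv_scalar (f : V -> R) Df : expoly f Df ->
  expolyv (fun x => (f x)%:M : 'rV_1) (fun x w => (Df x w)%:M : 'rV_1).
Proof.
by move=> ef j; apply: expoly_eq ef _ _ => [x|x w]; rewrite ord1 mxE.
Qed.

Lemma expolyv_pack (p V1 V2 nu : V -> 'rV[R]_4) r s Dp DV1 DV2 Dnu Dr Ds :
  expolyv p Dp -> expolyv V1 DV1 -> expolyv V2 DV2 -> expolyv nu Dnu ->
  expoly r Dr -> expoly s Ds ->
  expolyv (fun x => pack (p x) (V1 x) (V2 x) (nu x) (r x) (s x))
    (fun x w => pack (Dp x w) (DV1 x w) (DV2 x w) (Dnu x w) (Dr x w) (Ds x w)).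
Proof.
move=> ep eV1 eV2 enu er es.
exact: (expolyv_row_mx ep (expolyv_row_mx eV1 (expolyv_row_mx eV2
  (expolyv_row_mx enu (expolyv_row_mx (expolyv_scalar er) (expolyv_scalar es)))))).
Qed.

End Closure.

Lemma eq_pack {R : realType} (p V1 V2 nu p' V1' V2' nu' : 'rV[R]_4)
    (r s r' s' : R) :
  p = p' -> V1 = V1' -> V2 = V2' -> nu = nu' -> r = r' -> s = s' ->
  pack p V1 V2 nu r s = pack p' V1' V2' nu' r' s'.
Proof. by move=> -> -> -> -> -> ->. Qed.

Section Fields.
Context {R : realType} (B : 'M[R]_4) (theta : R).
Local Notation V := 'rV[R]_18.

Lemma expolyv_block4 k : expolyv (@block4 R k) (fun _ w => block4 k w).
Proof.
by move=> j; apply: expoly_eq (expoly_coord (inord (k + j))) _ _ => [x|x w];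
  rewrite mxE.
Qed.

(** The differential of Z at x, applied to the vector w; primes mark the blocks
    of w.  The formula is kept explicit because the bracket is computed from it. *)
Definition DZfield (x w : V) : V :=
  let p := pt_of x in let V1 := V1_of x in let V2 := V2_of x in
  let nu := nu_of x in let r := r_of x in let s := s_of x in
  let p' := pt_of w in let V1' := V1_of w in let V2' := V2_of w in
  let nu' := nu_of w in let r' := r_of w in let s' := s_of w in
  let a := expR r in let b := expR (- r) in
  let c := cos theta in let d := sin theta in
  pack
    (b *: (c *: V1' + d *: V2') - (b * r') *: (c *: V1 + d *: V2))
    (s' *: V2 + s *: V2'
     + c *: (a *: nu' + (a * r') *: nu - (b *: p' - (b * r') *: p)))
    (- (s' *: V1) - s *: V1'
     - d *: (a *: nu' + (a * r') *: nu + (b *: p' - (b * r') *: p)))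
    (a *: (- (c *: V1') + d *: V2') + (a * r') *: (- (c *: V1) + d *: V2))
    (dot (mxact B p') nu + dot (mxact B p) nu')
    (c * (dot (mxact B V2') (b *: nu - a *: p)
        + dot (mxact B V2) (b *: nu' - (b * r') *: nu - (a *: p' + (a * r') *: p)))
     - d * (dot (mxact B V1') (b *: nu + a *: p)
        + dot (mxact B V1) (b *: nu' - (b * r') *: nu + (a *: p' + (a * r') *: p)))).

Definition DWfield (x w : V) : V :=
  let p := pt_of x in let V1 := V1_of x in let V2 := V2_of x in
  let nu := nu_of x in let r := r_of x in let s := s_of x in
  let p' := pt_of w in let V1' := V1_of w in let V2' := V2_of w in
  let nu' := nu_of w in let r' := r_of w in let s' := s_of w in
  let a := expR r in let b := expR (- r) in
  let c := cos theta in let d := sin theta in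
  let e := dot (mxact B p) nu in
  let e' := dot (mxact B p') nu + dot (mxact B p) nu' in
  pack
    (b *: (c *: V2' - d *: V1') - (b * r') *: (c *: V2 - d *: V1))
    (- (e' *: V2 + e *: V2')
     + d *: (- (a *: nu' + (a * r') *: nu) + (b *: p' - (b * r') *: p)))
    (e' *: V1 + e *: V1'
     - c *: (a *: nu' + (a * r') *: nu + (b *: p' - (b * r') *: p)))
    (a *: (d *: V1' + c *: V2') + (a * r') *: (d *: V1 + c *: V2))
    s'
    (- 2 * r' * b ^+ 2 - 2 * r' * a ^+ 2
     - d * (dot (mxact B V2') (b *: nu - a *: p)
        + dot (mxact B V2) (b *: nu' - (b * r') *: nu - (a *: p' + (a * r') *: p)))
     - c * (dot (mxact B V1') (b *: nu + a *: p)
        + dot (mxact B V1) (b *: nu' - (b * r') *: nu + (a *: p' + (a * r') *: p)))).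

Let ep : expolyv (@pt_of R) (fun _ w => pt_of w) := expolyv_block4 0.
Let eV1 : expolyv (@V1_of R) (fun _ w => V1_of w) := expolyv_block4 4.
Let eV2 : expolyv (@V2_of R) (fun _ w => V2_of w) := expolyv_block4 8.
Let enu : expolyv (@nu_of R) (fun _ w => nu_of w) := expolyv_block4 12.
Let er : expoly (@r_of R) (fun _ w => r_of w) := expoly_coord _.
Let es : expoly (@s_of R) (fun _ w => s_of w) := expoly_coord _.

Let ea : expoly (fun x : V => expR (r_of x)) (fun x w => expR (r_of x) * r_of w).
Proof. by apply: expoly_eq (expoly_exp er) _ _ => // x w; rewrite mulrC. Qed.

Let eb : expoly (fun x : V => expR (- r_of x))
  (fun x w => - (expR (- r_of x) * r_of w)).
Proof.
by apply: expoly_eq (expoly_exp (expolyN er)) _ _ => // x w; rewrite mulNr mulrC.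
Qed.

Let ebeta : expoly (fun x : V => dot (mxact B (pt_of x)) (nu_of x))
  (fun x w => dot (mxact B (pt_of w)) (nu_of x)
            + dot (mxact B (pt_of x)) (nu_of w)) :=
  expoly_dot (expolyv_mxact B ep) enu.

Lemma expR2 (r : R) : expR (2 * r) = expR r ^+ 2.
Proof. by rewrite -expRM_natl. Qed.

Lemma expolyv_Zfield : expolyv (Zfield B theta) DZfield.
Proof.
have eanu := expolyvZ ea enu; have ebp := expolyvZ eb ep.
have eap := expolyvZ ea ep; have ebnu := expolyvZ eb enu.
have cV1 := expolyv_constZ (cos theta) eV1.
have dV2 := expolyv_constZ (sin theta) eV2.
have e := expolyv_pack (expolyvZ eb (expolyvD cV1 dV2))
  (expolyvD (expolyvZ es eV2) (expolyv_constZ (cos theta)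
     (expolyvD eanu (expolyvN ebp))))
  (expolyvD (expolyvN (expolyvZ es eV1)) (expolyvN (expolyv_constZ (sin theta)
     (expolyvD eanu ebp))))
  (expolyvZ ea (expolyvD (expolyvN cV1) dV2))
  ebeta
  (expolyD (expolyM (expoly_cst (cos theta)) (expoly_dot (expolyv_mxact B eV2)
      (expolyvD ebnu (expolyvN eap))))
    (expolyN (expolyM (expoly_cst (sin theta)) (expoly_dot (expolyv_mxact B eV1)
      (expolyvD ebnu eap))))).
apply: expolyv_eq e (fun _ => erefl) _ => x w.
rewrite /DZfield; cbv beta zeta; apply: eq_pack.
1-4: by apply/rowP => i; rewrite !mxE; ring.
  by [].
by rewrite !dot_linE; ring.
Qed.

Lemma expolyv_Wfield : expolyv (Wfield B theta) DWfield.
Proof.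
have eanu := expolyvZ ea enu; have ebp := expolyvZ eb ep.
have eap := expolyvZ ea ep; have ebnu := expolyvZ eb enu.
have cV2 := expolyv_constZ (cos theta) eV2.
have dV1 := expolyv_constZ (sin theta) eV1.
have e := expolyv_pack (expolyvZ eb (expolyvD cV2 (expolyvN dV1)))
  (expolyvD (expolyvN (expolyvZ ebeta eV2)) (expolyv_constZ (sin theta)
     (expolyvD (expolyvN eanu) ebp)))
  (expolyvD (expolyvZ ebeta eV1) (expolyvN (expolyv_constZ (cos theta)
     (expolyvD eanu ebp))))
  (expolyvZ ea (expolyvD dV1 cV2))
  es
  (expolyD (expolyD (expolyD (expolyM eb eb) (expolyN (expolyM ea ea)))
    (expolyN (expolyM (expoly_cst (sin theta)) (expoly_dot (expolyv_mxact B eV2)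
      (expolyvD ebnu (expolyvN eap))))))
    (expolyN (expolyM (expoly_cst (cos theta)) (expoly_dot (expolyv_mxact B eV1)
      (expolyvD ebnu eap))))).
apply: expolyv_eq e _ _ => [x|x w].
  by rewrite /Wfield -[- (2 * _)]mulrN !expR2.
rewrite /DWfield; cbv beta zeta; apply: eq_pack.
1-4: by apply/rowP => i; rewrite !mxE; ring.
  by [].
by rewrite !dot_linE; ring.
Qed.

Definition of_packE := (@pt_of_pack R, @V1_of_pack R, @V2_of_pack R,
  @nu_of_pack R, @r_of_pack R, @s_of_pack R).

(** The identities are polynomial in the entries of the vectors, a, b, and the
    numbers <Bu, v>, once the latter are reduced by skew-symmetry.  They hold
    identically in (cos theta, sin theta) once the factor cos^2 + sin^2 = 1 is
    restored where it is hidden, namely in b^2 - a^2 and in its derivative. *)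
Lemma Zfield_Wfield_commute x : so4 B ->
  DZfield x (Wfield B theta x) = DWfield x (Zfield B theta x).
Proof.
move=> hB; set w := Wfield B theta x; set z := Zfield B theta x.
have w1 : pt_of w = _ := pt_of_pack _ _ _ _ _ _.
have w2 : V1_of w = _ := V1_of_pack _ _ _ _ _ _.
have w3 : V2_of w = _ := V2_of_pack _ _ _ _ _ _.
have w4 : nu_of w = _ := nu_of_pack _ _ _ _ _ _.
have w5 : r_of w = _ := r_of_pack _ _ _ _ _ _.
have w6 : s_of w = _ := s_of_pack _ _ _ _ _ _.
have z1 : pt_of z = _ := pt_of_pack _ _ _ _ _ _.
have z2 : V1_of z = _ := V1_of_pack _ _ _ _ _ _.
have z3 : V2_of z = _ := V2_of_pack _ _ _ _ _ _.
have z4 : nu_of z = _ := nu_of_pack _ _ _ _ _ _.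
have z5 : r_of z = _ := r_of_pack _ _ _ _ _ _.
have z6 : s_of z = _ := s_of_pack _ _ _ _ _ _.
rewrite -[- (2 * _)]mulrN !expR2 in w6.
(* Only the values of the blocks matter from here on. *)
clearbody w z; rewrite /DZfield /DWfield; cbv zeta.
set p := pt_of x in w1 w2 w3 w4 w5 w6 z1 z2 z3 z4 z5 z6 *.
set V1 := V1_of x in w1 w2 w3 w4 w5 w6 z1 z2 z3 z4 z5 z6 *.
set V2 := V2_of x in w1 w2 w3 w4 w5 w6 z1 z2 z3 z4 z5 z6 *.
set nu := nu_of x in w1 w2 w3 w4 w5 w6 z1 z2 z3 z4 z5 z6 *.
set r := r_of x in w1 w2 w3 w4 w5 w6 z1 z2 z3 z4 z5 z6 *.
set s := s_of x in w1 w2 w3 w4 w5 w6 z1 z2 z3 z4 z5 z6 *.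
set a := expR r in w1 w2 w3 w4 w5 w6 z1 z2 z3 z4 z5 z6 *.
set b := expR (- r) in w1 w2 w3 w4 w5 w6 z1 z2 z3 z4 z5 z6 *.
have cd := cos2Dsin2 theta.
set c := cos theta in cd w1 w2 w3 w4 w5 w6 z1 z2 z3 z4 z5 z6 *.
set d := sin theta in cd w1 w2 w3 w4 w5 w6 z1 z2 z3 z4 z5 z6 *.
have unit_factor (t : R) : t = t * (c ^+ 2 + d ^+ 2) by rewrite cd mulr1.
rewrite [b ^+ 2 - a ^+ 2]unit_factor in w6.
have skew := (so4_dot V1 p hB, so4_dot V2 p hB, so4_dot nu p hB,
  so4_dot V2 V1 hB, so4_dot nu V1 hB, so4_dot nu V2 hB,
  so4_dot_diag V1 hB, so4_dot_diag V2 hB,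
  so4_dot_diag p hB, so4_dot_diag nu hB).
clearbody p V1 V2 nu r s a b c d.
rewrite w1 w2 w3 w4 w5 z1 z2 z3 z4 z5; apply: eq_pack.
- by apply/rowP => i; rewrite !mxE; ring.
- rewrite w6 !dot_linE !skew; apply/rowP => i; rewrite !mxE; ring.
- rewrite w6 !dot_linE !skew; apply/rowP => i; rewrite !mxE; ring.
- by apply/rowP => i; rewrite !mxE; ring.
- rewrite z6 !dot_linE !skew; ring.
- rewrite [X in _ = X - _ - _]unit_factor !dot_linE !skew; ring.
Qed.


End Fields.

(** * Orthonormal frames and bounds on the flow *)

Section Frames.
Context {R : realType}.

(** A square matrix has orthonormal rows iff it has orthonormal columns. *)
Lemma orthonormal_transpose n (e : 'I_n -> 'rV[R]_n) :
  (forall k l, dot (e k) (e l) = (k == l)%:R) <->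
  (forall i j, \sum_k e k 0 i * e k 0 j = (i == j)%:R).
Proof.
pose M := \matrix_(k, j) e k 0 j.
have ME k l : (M *m M^T) k l = dot (e k) (e l).
  by rewrite mxE dotE; apply: eq_bigr => j _; rewrite !mxE.
have MtE i j : (M^T *m M) i j = \sum_k e k 0 i * e k 0 j.
  by rewrite mxE; apply: eq_bigr => k _; rewrite !mxE.
have MMt : (forall k l, dot (e k) (e l) = (k == l)%:R) <-> M *m M^T = 1%:M.
  split=> [h|h k l]; last by rewrite -ME h mxE.
  by apply/matrixP => k l; rewrite ME h mxE.
have MtM : (forall i j, \sum_k e k 0 i * e k 0 j = (i == j)%:R) <->
    M^T *m M = 1%:M.
  split=> [h|h i j]; last by rewrite -MtE h mxE.
  by apply/matrixP => i j; rewrite MtE h mxE.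
by split=> [/MMt/mulmx1C/MtM|/MtM/mulmx1C/MMt].
Qed.

Definition frame (x : 'rV[R]_18) : 4.-tuple 'rV[R]_4 :=
  [tuple pt_of x; V1_of x; V2_of x; nu_of x].

Definition orthonormal_frame (x : 'rV[R]_18) : Prop :=
  forall k l, dot (tnth (frame x) k) (tnth (frame x) l) = (k == l)%:R.

(** The entries of F^T F, where the rows of F are the vectors of the frame.  It is
    these, and not the entries of F F^T, that are first integrals of Z and W on
    the whole space. *)
Definition gram_entry (i j : 'I_4) (x : 'rV[R]_18) : R :=
  pt_of x 0 i * pt_of x 0 j + V1_of x 0 i * V1_of x 0 j
  + V2_of x 0 i * V2_of x 0 j + nu_of x 0 i * nu_of x 0 j.

Lemma orthonormal_frameP x :
  orthonormal_frame x <-> forall i j, gram_entry i j x = (i == j)%:R.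
Proof.
have E i j : \sum_k tnth (frame x) k 0 i * tnth (frame x) k 0 j = gram_entry i j x.
  by rewrite !big_ord_recl big_ord0 addr0 /gram_entry !addrA.
split=> [/(orthonormal_transpose (tnth (frame x))) h i j|h].
  by rewrite -E.
by apply/(orthonormal_transpose (tnth (frame x))) => i j; rewrite E.
Qed.

Definition gram_diff (i j : 'I_4) (x w : 'rV[R]_18) : R :=
  let D (f : 'rV[R]_18 -> 'rV[R]_4) :=
    f w 0 i * f x 0 j + f x 0 i * f w 0 j in
  D (@pt_of R) + D (@V1_of R) + D (@V2_of R) + D (@nu_of R).

Lemma expoly_gram_entry i j : expoly (gram_entry i j) (gram_diff i j).
Proof.
have e k := expolyM (@expolyv_block4 R k i) (@expolyv_block4 R k j).
exact: expolyD (expolyD (expolyD (e 0) (e 4)) (e 8)) (e 12).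
Qed.

(** Z acts on the frame by a skew-symmetric matrix A, and
    (F^T F)' = F^T (A^T + A) F. *)
Lemma gram_diff_Z (B : 'M[R]_4) theta i j x :
  gram_diff i j x (Zfield B theta x) = 0.
Proof. by rewrite /gram_diff /Zfield !of_packE !mxE; ring. Qed.

Lemma gram_diff_W (B : 'M[R]_4) theta i j x :
  gram_diff i j x (Wfield B theta x) = 0.
Proof. by rewrite /gram_diff /Wfield !of_packE !mxE; ring. Qed.

Lemma orthonormal_frame_curve (F : 'rV[R]_18 -> 'rV[R]_18) y t :
  (forall i j x, gram_diff i j x (F x) = 0) -> integral_curve F y ->
  orthonormal_frame (y 0) -> orthonormal_frame (y t).
Proof.
move=> F0 yF /orthonormal_frameP h; apply/orthonormal_frameP => i j.
rewrite -h; apply: (@is_derive_0_is_cst R (fun t => gram_entry i j (y t))) => s.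
by apply: is_derive_eq (expoly_curve (expoly_gram_entry i j) (yF s)) _.
Qed.

Lemma norm_le1_dot n (u : 'rV[R]_n) : dot u u = 1 -> `|u| <= 1.
Proof.
move=> u1; apply: norm_le_entries => // i.
rewrite -(ler_pXn2r (n := 2))// ?nnegrE// expr1n real_normK ?num_real//.
rewrite -u1 dotE (bigD1 i)//= -expr2 lerDl; apply: sumr_ge0 => j _.
by rewrite -expr2 sqr_ge0.
Qed.

Lemma norm_row_mx_le m n (u : 'rV[R]_m) (v : 'rV[R]_n) c :
  `|u| <= c -> `|v| <= c -> `|row_mx u v| <= c.
Proof.
move=> uc vc; apply: norm_le_entries => [|i]; first exact: le_trans uc.
case: (split_ordP i) => j ->; rewrite ?row_mxEl ?row_mxEr.
  exact: le_trans (norm_entry u j) uc.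
exact: le_trans (norm_entry v j) vc.
Qed.

Lemma norm_pack_le (p V1 V2 nu : 'rV[R]_4) r s c :
  `|p| <= c -> `|V1| <= c -> `|V2| <= c -> `|nu| <= c -> `|r| <= c ->
  `|s| <= c -> `|pack p V1 V2 nu r s| <= c.
Proof.
move=> pc V1c V2c nuc rc sc; have c0 : 0 <= c by exact: le_trans pc.
have scalar (t : R) : `|t| <= c -> `|t%:M : 'rV_1| <= c.
  by move=> tc; apply: norm_le_entries => // i; rewrite ord1 mxE.
exact: (norm_row_mx_le pc (norm_row_mx_le V1c (norm_row_mx_le V2c
  (norm_row_mx_le nuc (norm_row_mx_le (scalar r rc) (scalar s sc)))))).
Qed.

Lemma block4_entry k (x : 'rV[R]_18) (i : 'I_18) : (k <= i < k + 4)%N ->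
  `|x 0 i| <= `|block4 k x|.
Proof.
move=> /andP[ki ik4]; have ik : (i - k < 4)%N by rewrite ltn_subLR.
rewrite (_ : x 0 i = block4 k x 0 (Ordinal ik)); first exact: norm_entry.
by rewrite mxE; congr (x _ _); apply: val_inj; rewrite /= subnKC// inordK.
Qed.

Lemma norm_le_blocks (x : 'rV[R]_18) c :
  `|pt_of x| <= c -> `|V1_of x| <= c -> `|V2_of x| <= c -> `|nu_of x| <= c ->
  `|r_of x| <= c -> `|s_of x| <= c -> `|x| <= c.
Proof.
move=> pc V1c V2c nuc rc sc.
apply: norm_le_entries => [|i]; first exact: le_trans pc.
have [i4|i4] := ltnP i 4; first exact: le_trans (@block4_entry 0 _ _ _) pc.
have [i8|i8] := ltnP i 8.
  by apply: le_trans (@block4_entry 4 _ _ _) V1c; rewrite i4.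
have [i12|i12] := ltnP i 12.
  by apply: le_trans (@block4_entry 8 _ _ _) V2c; rewrite i8.
have [i16|i16] := ltnP i 16.
  by apply: le_trans (@block4_entry 12 _ _ _) nuc; rewrite i12.
have [i17|i17] := ltnP i 17.
  rewrite (_ : i = inord 16)//; apply: val_inj; rewrite /= inordK//.
  by apply/eqP; rewrite eqn_leq i16 andbT -ltnS.
rewrite (_ : i = inord 17)//; apply: val_inj; rewrite /= inordK//.
by apply/eqP; rewrite eqn_leq i17 andbT -ltnS.
Qed.

Lemma orthonormal_frame_norm x : orthonormal_frame x ->
  [/\ `|pt_of x| <= 1, `|V1_of x| <= 1, `|V2_of x| <= 1 & `|nu_of x| <= 1].
Proof.
move=> h; split; apply: norm_le1_dot.
- exact: (h (@Ordinal 4 0 isT) (@Ordinal 4 0 isT)).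
- exact: (h (@Ordinal 4 1 isT) (@Ordinal 4 1 isT)).
- exact: (h (@Ordinal 4 2 isT) (@Ordinal 4 2 isT)).
- exact: (h (@Ordinal 4 3 isT) (@Ordinal 4 3 isT)).
Qed.

(** The r-component <Bp, nu> of Z depends on the frame only, so it may be
    evaluated at a point with r = s = 0, which lies in the unit ball. *)
Lemma rate_r_bound (B : 'M[R]_4) theta : exists C, forall x,
  orthonormal_frame x -> `|r_of (Zfield B theta x)| <= C.
Proof.
have [C _ HC] := expolyv_taylor 1 (expolyv_Zfield B theta).
exists C => x /orthonormal_frame_norm[p1 V1 V2 nu1].
pose y := pack (pt_of x) (V1_of x) (V2_of x) (nu_of x) 0 0.
have y1 : `|y| <= 1 by apply: norm_pack_le; rewrite // normr0.
have [|ZC _ _] := HC y 0 y1; first by rewrite normr0.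
apply: le_trans ZC; rewrite (_ : r_of _ = r_of (Zfield B theta y)).
  exact: norm_entry.
have Zr z : r_of (Zfield B theta z) = _ := r_of_pack _ _ _ _ _ _.
have yp : pt_of y = pt_of x := pt_of_pack _ _ _ _ _ _.
have ynu : nu_of y = nu_of x := nu_of_pack _ _ _ _ _ _.
by apply: etrans (Zr x) (etrans _ (esym (Zr y))); rewrite yp ynu.
Qed.

(** Likewise, the s-component of Z does not involve s, so it may be evaluated at
    s = 0, in the ball of radius max(1, r). *)
Lemma rate_s_bound (B : 'M[R]_4) theta (r : R) : exists C, forall x,
  orthonormal_frame x -> `|r_of x| <= r -> `|s_of (Zfield B theta x)| <= C.
Proof.
pose M := Num.max 1 r.
have [C _ HC] := expolyv_taylor M (expolyv_Zfield B theta).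
have M1 : 1 <= M by rewrite le_max lexx.
have M0 : 0 <= M by exact: le_trans M1.
exists C => x /orthonormal_frame_norm[p1 V1 V2 nu1] xr.
pose y := pack (pt_of x) (V1_of x) (V2_of x) (nu_of x) (r_of x) 0.
have yM : `|y| <= M.
  apply: norm_pack_le; rewrite ?normr0//; try exact: le_trans M1.
  by rewrite (le_trans xr)// le_max lexx orbT.
have [|ZC _ _] := HC y 0 yM; first by rewrite normr0.
apply: le_trans ZC; rewrite (_ : s_of _ = s_of (Zfield B theta y)).
  exact: norm_entry.
have Zs z : s_of (Zfield B theta z) = _ := s_of_pack _ _ _ _ _ _.
have yp : pt_of y = pt_of x := pt_of_pack _ _ _ _ _ _.
have yV1 : V1_of y = V1_of x := V1_of_pack _ _ _ _ _ _.
have yV2 : V2_of y = V2_of x := V2_of_pack _ _ _ _ _ _.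
have ynu : nu_of y = nu_of x := nu_of_pack _ _ _ _ _ _.
have yr : r_of y = r_of x := r_of_pack _ _ _ _ _ _.
by apply: etrans (Zs x) (etrans _ (esym (Zs y))); rewrite yp yV1 yV2 ynu yr.
Qed.

(** On a compact interval, the curve y(0, .) is bounded by continuity.  From it,
    the flow of Z moves r at a bounded rate, hence r stays bounded, hence s moves
    at a bounded rate; the frame is bounded since it is orthonormal. *)
Lemma flow_bounded (B : 'M[R]_4) theta (y : R -> R -> 'rV[R]_18) (T : R) :
  (forall v, integral_curve (Zfield B theta) (y ^~ v)) ->
  integral_curve (Wfield B theta) (y 0) ->
  (forall u v, orthonormal_frame (y u v)) ->
  exists M, forall u v, `|u| <= T -> `|v| <= T -> `|y u v| <= M.
Proof.
move=> yZ yW yo.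
have [Mr hMr] := continuous_bounded_itv T (is_derive_continuous (yW^~ (inord 16))).
have [Ms hMs] := continuous_bounded_itv T (is_derive_continuous (yW^~ (inord 17))).
have [Cr hCr] := rate_r_bound B theta.
have linear_growth (f df : R -> R) C N u : (forall t, is_derive t (1 : R) f (df t)) ->
    `|u| <= T -> `|f 0| <= N -> (forall t, `|t| <= T -> `|df t| <= C) ->
    `|f u| <= C * T + N.
  move=> fd uT fN dfC; rewrite -[f u](subrK (f 0)) (le_trans (ler_normD _ _))//.
  rewrite lerD//; apply: (le_trans (mean_value_bound fd (K := C) _)) => [t tu|].
    by apply: dfC; exact: le_trans uT.
  rewrite ler_wpM2l//; apply: le_trans (dfC 0 _) => //.
  by rewrite normr0 (le_trans _ uT).
pose N := Cr * T + Mr.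
have yr u v : `|u| <= T -> `|v| <= T -> `|r_of (y u v)| <= N.
  move=> uT vT; apply: (linear_growth (fun u => r_of (y u v)) _ Cr Mr u (yZ v ^~ (inord 16))) => //.
    exact: hMr.
  by move=> t _; apply: hCr; exact: yo.
have [Cs hCs] := rate_s_bound B theta N.
have ys u v : `|u| <= T -> `|v| <= T -> `|s_of (y u v)| <= Cs * T + Ms.
  move=> uT vT; apply: (linear_growth (fun u => s_of (y u v)) _ Cs Ms u (yZ v ^~ (inord 17))) => //.
    exact: hMs.
  by move=> t tT; apply: hCs; [exact: yo|exact: yr].
exists (Num.max 1 (Num.max N (Cs * T + Ms))) => u v uT vT.
have [p1 V11 V21 nu1] := orthonormal_frame_norm (yo u v).
apply: norm_le_blocks; rewrite !le_max; apply/orP; try by left.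
  by right; rewrite yr.
by right; rewrite ys ?orbT.
Qed.

End Frames.

(** * Conjugate frames of a surface *)

Lemma ord2P (i : 'I_2) : i = 0 \/ i = 1.
Proof. by case: i => -[|[|//]] h; [left|right]; apply: val_inj. Qed.

(** Two maps f and N whose differentials at w are, in an orthonormal pair
    (V1, V2), a rotation of angle theta (c and d are its
    cosine and sine) scaled by b, resp. the same rotation followed by
    diag(-1, 1) and scaled by a = 1 / b. *)
Section PrincipalFrame.
Context {R : realType}.
Variables (f N : 'rV[R]_2 -> 'rV[R]_4) (w : 'rV[R]_2) (V1 V2 : 'rV[R]_4).
Variables a b c d : R.
Hypothesis V11 : dot V1 V1 = 1.
Hypothesis V22 : dot V2 V2 = 1.
Hypothesis V12 : dot V1 V2 = 0.
Hypothesis cd : c ^+ 2 + d ^+ 2 = 1.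
Hypothesis ab : a * b = 1.
Hypothesis df : forall X, 'd f w X =
  X 0 0 *: (b *: (c *: V1 + d *: V2)) + X 0 1 *: (b *: (c *: V2 - d *: V1)).
Hypothesis dN : forall X, 'd N w X =
  X 0 0 *: (a *: (- (c *: V1) + d *: V2)) + X 0 1 *: (a *: (d *: V1 + c *: V2)).

Let V21 : dot V2 V1 = 0. Proof. by rewrite dotC. Qed.

(** In the coordinates x1, x2 of df(X) in the frame, dN acts as
    a^2 diag(-1, 1); the factor a^2 comes from a = a^2 b. *)
Lemma differential_in_frame (X : 'rV[R]_2) :
  let x1 := b * (c * X 0 0 - d * X 0 1) in
  let x2 := b * (d * X 0 0 + c * X 0 1) in
  'd f w X = x1 *: V1 + x2 *: V2 /\
  'd N w X = a ^+ 2 *: (- (x1 *: V1) + x2 *: V2).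
Proof.
move=> x1 x2; rewrite /x1 /x2; split.
  by apply: (etrans (df X)); apply/rowP => i; rewrite !mxE; ring.
apply: (etrans (dN X)); apply/rowP => i; rewrite !mxE.
transitivity ((a * b) * a * ((d * X 0 0 + c * X 0 1) * V2 0 i
  - (c * X 0 0 - d * X 0 1) * V1 0 i)); last by ring.
by rewrite ab; ring.
Qed.

Lemma frame_combination_inj x1 x2 y1 y2 :
  x1 *: V1 + x2 *: V2 = y1 *: V1 + y2 *: V2 -> x1 = y1 /\ x2 = y2.
Proof.
move=> e; have := congr1 (dot V1) e; have := congr1 (dot V2) e.
by rewrite !dot_linE V11 V12 V21 V22 !mulr0 !mulr1 !add0r !addr0.
Qed.

Lemma frame_immersion : injective ('d f w).
Proof.
move=> X Y; have [eX _] := differential_in_frame X.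
have [eY _] := differential_in_frame Y => XY.
have /frame_combination_inj[e1 e2] := etrans (esym eX) (etrans XY eY).
have b0 : b != 0.
  by apply/eqP => b0; have := oner_neq0 R; rewrite -ab b0 mulr0 eqxx.
have {}e1 := mulfI b0 e1; have {}e2 := mulfI b0 e2.
have rot (x y : R) : x = c * (c * x - d * y) + d * (d * x + c * y)
    /\ y = c * (d * x + c * y) - d * (c * x - d * y).
  split; [rewrite -[LHS]mul1r|rewrite -[LHS]mul1r]; rewrite -cd; ring.
apply/rowP => i; case: (ord2P i) => ->.
  by rewrite (rot (X 0 0) (X 0 1)).1 e1 e2 -(rot _ _).1.
by rewrite (rot (X 0 0) (X 0 1)).2 e1 e2 -(rot _ _).2.
Qed.

(** The preimage of x1 V1 + x2 V2 under df is the inverse rotation scaled by a. *)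
Lemma principal_combination kappa x1 x2 :
  (x1 != 0) || (x2 != 0) ->
  a ^+ 2 * x1 = kappa * x1 -> - (a ^+ 2 * x2) = kappa * x2 ->
  principal f N w kappa (x1 *: V1 + x2 *: V2).
Proof.
move=> x0 k1 k2; split.
  apply/eqP => e; have := @frame_combination_inj x1 x2 0 0.
  rewrite !scale0r addr0 => /(_ e)[x10 x20].
  by move: x0; rewrite x10 x20 eqxx.
pose X : 'rV[R]_2 := \row_i (if i == 0 then a * (c * x1 + d * x2)
                             else a * (c * x2 - d * x1)).
have [e1 e2] := differential_in_frame X.
have X1 : b * (c * X 0 0 - d * X 0 1) = x1.
  rewrite !mxE/=; transitivity ((a * b) * (c ^+ 2 + d ^+ 2) * x1); first by ring.
  by rewrite ab cd !mul1r.
have X2 : b * (d * X 0 0 + c * X 0 1) = x2.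
  rewrite !mxE/=; transitivity ((a * b) * (c ^+ 2 + d ^+ 2) * x2); first by ring.
  by rewrite ab cd !mul1r.
rewrite X1 X2 in e1 e2.
exists X; first exact: e1.
apply: (etrans e2); apply/rowP => i; rewrite !mxE.
transitivity (- (kappa * x1 * V1 0 i + kappa * x2 * V2 0 i)); last by ring.
by rewrite -k1 -k2; ring.
Qed.

Lemma principal_V1 : principal f N w (a ^+ 2) V1.
Proof.
have := @principal_combination (a ^+ 2) 1 0.
by rewrite scale1r scale0r addr0; apply; rewrite ?oner_neq0// !mulr0 oppr0.
Qed.

Lemma principal_V2 : principal f N w (- a ^+ 2) V2.
Proof.
have := @principal_combination (- a ^+ 2) 0 1.
by rewrite scale1r scale0r add0r; apply; rewrite ?oner_neq0 ?orbT ?mulr0 ?mulr1.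
Qed.

Lemma principal_curvature_frame kappa :
  principal_curvature f N w kappa <-> kappa = a ^+ 2 \/ kappa = - a ^+ 2.
Proof.
split=> [[T [T0 [X fT NT]]]|[] ->]; last 2 first.
- by exists V1; exact: principal_V1.
- by exists V2; exact: principal_V2.
have [eX eN] := differential_in_frame X.
have TE := etrans (esym eX) fT; have := etrans (esym eN) NT.
set x1 := b * _ in TE *; set x2 := b * _ in TE *.
rewrite -TE => NE.
have /frame_combination_inj[/oppr_inj k1 k2] :
    (- (a ^+ 2 * x1)) *: V1 + (a ^+ 2 * x2) *: V2
    = (- (kappa * x1)) *: V1 + (- (kappa * x2)) *: V2.
  by apply/rowP => i; have := congr1 (fun v : 'rV_4 => v 0 i) NE; rewrite !mxE; lra.
have [x10|x10] := eqVneq x1 0; last by left; apply/esym/(mulIf x10).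
have [x20|x20] := eqVneq x2 0.
  by move: T0; rewrite -TE x10 x20 !scale0r addr0 eqxx.
by right; apply: (mulIf x20); rewrite mulNr k2 opprK.
Qed.

(** The first form is b^2 times the identity, and the second one has diagonal
    entries c^2 - d^2 and d^2 - c^2. *)
Lemma mean_curvature_frame : mean_curvature f N w = 0.
Proof.
have bb : fund_form1 f w = (b ^+ 2)%:M.
  apply/matrixP => i j; rewrite !mxE !df.
  case: (ord2P i) => ->; case: (ord2P j) => ->;
    rewrite !mxE/= !dot_linE V11 V12 V21 V22 ?mulr1n ?mulr0n;
    try (transitivity (b ^+ 2 * (c ^+ 2 + d ^+ 2)); [ring|by rewrite cd mulr1]);
    ring.
rewrite /mean_curvature bb invmx_scalar mul_scalar_mx mxtraceZ.
pose at_basis (u v : 'rV[R]_4) (i : 'I_2) : 'rV[R]_4 :=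
  (delta_mx 0 i : 'rV[R]_2) 0 0 *: u + (delta_mx 0 i : 'rV[R]_2) 0 1 *: v.
have II i : fund_form2 f N w i i = - dot
    (at_basis (a *: (- (c *: V1) + d *: V2)) (a *: (d *: V1 + c *: V2)) i)
    (at_basis (b *: (c *: V1 + d *: V2)) (b *: (c *: V2 - d *: V1)) i).
  by rewrite mxE; congr (- dot _ _); [exact: dN|exact: df].
rewrite /mxtrace !big_ord_recl big_ord0 !II.
by rewrite /at_basis !mxE/= !dot_linE V11 V12 V21 V22; ring.
Qed.

End PrincipalFrame.

(** * The surface *)

Lemma block4_linear {R : realType} k (a b : R) (u v : 'rV[R]_18) :
  block4 k (a *: u + b *: v) = a *: block4 k u + b *: block4 k v.
Proof. by apply/rowP => j; rewrite !mxE. Qed.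

Theorem theorem3p11 (R : realType) (B : 'M[R]_4) (theta : R)
    (p0 V10 V20 nu0 : 'rV[R]_4) (r0 s0 : R)
    (ThetaZ ThetaW : R -> 'rV[R]_18 -> 'rV[R]_18)
    (hB : so4 B)
    (h0 : orthonormal_basis [tuple p0; V10; V20; nu0])
    (hZ : is_flow (Zfield B theta) ThetaZ)
    (hW : is_flow (Wfield B theta) ThetaW) :
  let x0 := pack p0 V10 V20 nu0 r0 s0 in
  let phi := fun w : 'rV[R]_2 => ThetaZ (w 0 0) (ThetaW (w 0 1) x0) in
  let rho := fun w => pt_of (phi w) in
  let nu := fun w => nu_of (phi w) in
  [/\ (forall w, sphere3 (rho w)),
      minimal_immersion_S3 rho,
      gauss_map rho nu,
      (forall w kappa, principal_curvature rho nu w kappa <->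
         kappa = expR (2 * r_of (phi w)) \/ kappa = - expR (2 * r_of (phi w)))
    & (forall w, principal_direction rho nu w (V1_of (phi w)) /\
                 principal_direction rho nu w (V2_of (phi w)))].
Proof.
move=> x0; pose y u v := ThetaZ u (ThetaW v x0).
move=> phi rho nu.
have yZ v : integral_curve (Zfield B theta) (y ^~ v).
  exact: is_derive_integral_curve (hZ _).2.
have y0 : y 0 = ThetaW ^~ x0 by apply/funext => v; exact: (hZ _).1.
have yW : integral_curve (Wfield B theta) (y 0).
  by rewrite y0; exact: is_derive_integral_curve (hW _).2.
have x0o : orthonormal_frame x0.
  move=> k l; rewrite -(h0.2 k l) /frame.
  by rewrite pt_of_pack V1_of_pack V2_of_pack nu_of_pack.
have yo u v : orthonormal_frame (y u v).
  apply: (orthonormal_frame_curve u (gram_diff_Z B theta) (yZ v)).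
  apply: (orthonormal_frame_curve v (gram_diff_W B theta) yW).
  by rewrite y0 (hW x0).1.
have eZ := expolyv_Zfield B theta; have eW := expolyv_Wfield B theta.
have dphi w : is_diff w phi
    (fun X => X 0 0 *: Zfield B theta (phi w) + X 0 1 *: Wfield B theta (phi w)).
  apply: (commuting_flows_is_diff eZ eW (fun x => Zfield_Wfield_commute theta x hB) yZ yW).
  by move=> T; exact: flow_bounded yZ yW yo.
have dblock k w X : 'd (fun w => block4 k (phi w)) w X
    = X 0 0 *: block4 k (Zfield B theta (phi w))
      + X 0 1 *: block4 k (Wfield B theta (phi w)).
  have [_ dE] := is_diff_comp (dphi w) (expolyv_is_diff (phi w) (expolyv_block4 k)).
  exact: etrans (congr1 (@^~ X) dE) (block4_linear _ _ _ _ _).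
have smooth_block k : smooth (fun w => block4 k (phi w)).
  exact: (smooth_expoly_comp eZ eW dphi (expolyv_block4 k)).
pose c := cos theta; pose d := sin theta.
pose a w := expR (r_of (phi w)); pose b w := expR (- r_of (phi w)).
have drho w X : 'd rho w X =
    X 0 0 *: (b w *: (c *: V1_of (phi w) + d *: V2_of (phi w)))
    + X 0 1 *: (b w *: (c *: V2_of (phi w) - d *: V1_of (phi w))).
  by apply: etrans (dblock 0 w X) _; congr (_ *: _ + _ *: _); exact: pt_of_pack.
have dnu w X : 'd nu w X =
    X 0 0 *: (a w *: (- (c *: V1_of (phi w)) + d *: V2_of (phi w)))
    + X 0 1 *: (a w *: (d *: V1_of (phi w) + c *: V2_of (phi w))).
  by apply: etrans (dblock 12 w X) _; congr (_ *: _ + _ *: _); exact: nu_of_pack.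
have cd : c ^+ 2 + d ^+ 2 = 1 by exact: cos2Dsin2.
have ab w : a w * b w = 1 by exact: expRxMexpNx_1.
have fo w k l : dot (tnth (frame (phi w)) k) (tnth (frame (phi w)) l) = (k == l)%:R.
  exact: yo.
have pp w : dot (rho w) (rho w) = 1 := fo w (@Ordinal 4 0 isT) (@Ordinal 4 0 isT).
have V11 w : dot (V1_of (phi w)) (V1_of (phi w)) = 1 :=
  fo w (@Ordinal 4 1 isT) (@Ordinal 4 1 isT).
have V22 w : dot (V2_of (phi w)) (V2_of (phi w)) = 1 :=
  fo w (@Ordinal 4 2 isT) (@Ordinal 4 2 isT).
have nunu w : dot (nu w) (nu w) = 1 := fo w (@Ordinal 4 3 isT) (@Ordinal 4 3 isT).
have V12 w : dot (V1_of (phi w)) (V2_of (phi w)) = 0 :=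
  fo w (@Ordinal 4 1 isT) (@Ordinal 4 2 isT).
have nup w : dot (nu w) (rho w) = 0 :=
  fo w (@Ordinal 4 3 isT) (@Ordinal 4 0 isT).
have nuV1 w : dot (nu w) (V1_of (phi w)) = 0 :=
  fo w (@Ordinal 4 3 isT) (@Ordinal 4 1 isT).
have nuV2 w : dot (nu w) (V2_of (phi w)) = 0 :=
  fo w (@Ordinal 4 3 isT) (@Ordinal 4 2 isT).
have gauss : gauss_map rho nu.
  split=> [|w]; first exact: (smooth_block 12).
  split=> [||X]; [exact: nunu|exact: nup|].
  by rewrite drho !dot_linE nuV1 nuV2; ring.
split=> //.
- split; first split.
  + exact: (smooth_block 0).
  + exact: pp.
  + by move=> w; exact: frame_immersion (V11 w) (V22 w) (V12 w) cd (ab w) (drho w) (dnu w).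
  + exists nu => // w.
    exact: mean_curvature_frame (V11 w) (V22 w) (V12 w) cd (drho w) (dnu w).
- move=> w kappa; rewrite expR2.
  exact: principal_curvature_frame (V11 w) (V22 w) (V12 w) cd (ab w) (drho w) (dnu w) kappa.
- move=> w; split.
    exists (a w ^+ 2).
    exact: principal_V1 (V11 w) (V22 w) (V12 w) cd (ab w) (drho w) (dnu w).
  exists (- a w ^+ 2).
  exact: principal_V2 (V11 w) (V22 w) (V12 w) cd (ab w) (drho w) (dnu w).
Qed.
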